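(* For every $M>2$ there exist constants $\delta_0=\delta_0(M)>0$, $c_1^*=c_1^*(M)>0$ and $C_1^*=C_1^*(M)>0$ such that the following holds. Let $\Omega$ be a normalised convex planar domain with torsion function $v$, attaining its maximum at $(x^*,y^* )$, and suppose that $\Omega$ has Property 1 for this $M$ and for some value $\delta$ with $0<\delta\le\delta_0$. For each unit direction $n=(n_1,n_2)$, $n_1^2+n_2^2=1$, put $\alpha_n=\max\{|n_2|^2,\delta\}$. Then $$\frac1{C_1^*}\,\alpha_n\le-\partial_n^2v(x,y)\le C_1^*\,\alpha_n\qquad\text{for all }(x,y)\in B_{c_1^*}(x^*,y^* ),$$ where $\partial_n^2v$ denotes the second directional derivative of $v$ in the direction $n$ and $B_r(x^*,y^* )$ is the disc of radius $r$ centred at $(x^*,y^* )$.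
   Context: Normalised domain: $\Omega\subset\mathbb{R}^2$ is a convex planar domain, rotated so that its projection onto the $y$-axis is the shortest among its projections onto all directions, and translated and dilated so that $\Omega=\{(x,y)\in\mathbb{R}^2: x\in[a,b],\ f_1(x)\le y\le f_2(x)\}$ with $f_1$ convex, $f_2$ concave, $0\le f_1\le f_2\le 1$, and such that the (concave) height function $h(x)=f_2(x)-f_1(x)$ satisfies $\max_{[a,b]}h=1$. The torsion function $v$ solves $\Delta v=-1$ in $\Omega$, $v=0$ on $\partial\Omega$; $(x^*,y^* )$ is the point where $v$ attains its maximum. $\bar x\in[a,b]$ is a point with $h(\bar x)=1$. The quantity Error: for $\tilde x\in[a,b]$ put $d(\tilde x)=\min\{\tilde x-a,b-\tilde x\}$ and $$\mathrm{Error}(\tilde x)=C_1e^{-c_1d(\tilde x)}+C_1\sup_{|x-\tilde x|\le\frac34d(\tilde x)}e^{-c_1|x-\tilde x|}|h(x)-h(\tilde x)|.$$ Here $c_1,C_1>0$ are fixed constants, independent of $\Omega$, for which the following holds with a fixed, sufficiently small absolute constant $c^*\in(0,\tfrac12)$: for every normalised convex domain and every $\tilde x$ with $h(\tilde x)\ge\tfrac12$, one has $|v(\tilde x,y)-v_1(\tilde x,y)|\le\mathrm{Error}(\tilde x)$ and $|\partial_xv(\tilde x,y)|\le\mathrm{Error}(\tilde x)$ for all $y\in[f_1(\tilde x)+c^*,f_2(\tilde x)-c^*]$, where $v_1(x,y)=\tfrac12(y-f_1(x))(f_2(x)-y)$. (Such constants exist.) Property 1 (for given $M>2$ and $\delta$):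 $[\bar x-M,\bar x+M]\subset[a,b]$, $0\le\delta\le\tfrac12\min\{1-h(\bar x+M),\,1-h(\bar x-M)\}$, and, with $x_-\in[\bar x-M,\bar x]$ and $x_+\in[\bar x,\bar x+M]$ points such that $h(x_\pm)=1-2\delta$, one has $\mathrm{Error}(\tilde x)\le\tfrac1{100}\delta$ for every $\tilde x\in[x_-,x_+]$. *)

(* Defs.v *)
From mathcomp Require Import all_boot all_order all_algebra.
From mathcomp Require Import all_classical all_reals all_analysis.
Set Implicit Arguments.
Unset Strict Implicit.
Unset Printing Implicit Defensive.
Import Order.TTheory GRing.Theory Num.Theory.
Import numFieldNormedType.Exports.
Local Open Scope classical_set_scope.
Local Open Scope ring_scope.

(* The data [a, b], f_1, f_2 describing a planar region; the values of f_1 and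
   f_2 outside [a, b] play no role. *)
Record profile (R : realType) := Profile {
  pa : R;
  pb : R;
  f1 : R -> R;
  f2 : R -> R }.

Definition region (R : realType) (P : profile R) : set (R * R) :=
  [set p | pa P <= p.1 <= pb P /\ f1 P p.1 <= p.2 <= f2 P p.1].

Definition height (R : realType) (P : profile R) (x : R) : R := f2 P x - f1 P x.

Definition projection (R : realType) (A : set (R * R)) (u : R * R) : set R :=
  [set p.1 * u.1 + p.2 * u.2 | p in A].

(* For a nonempty bounded convex A the projection is an interval, whose length
   this is. *)
Definition projection_length (R : realType) (A : set (R * R)) (u : R * R) : R :=
  sup (projection A u) - inf (projection A u).

Definition unit_direction (R : realType) (u : R * R) : Prop :=
  u.1 ^+ 2 + u.2 ^+ 2 = 1.

Definition normalised (R : realType) (P : profile R) : Prop :=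
  [/\ pa P < pb P,
      convex_function (`[pa P, pb P] : set R) (f1 P)
      /\ convex_function (`[pa P, pb P] : set R) (fun x => - f2 P x),
      forall x, x \in `[pa P, pb P] ->
        [/\ 0 <= f1 P x, f1 P x <= f2 P x & f2 P x <= 1],
      (forall x, x \in `[pa P, pb P] -> height P x <= 1)
      /\ (exists2 x, x \in `[pa P, pb P] & height P x = 1)
    & forall u, unit_direction u ->
        projection_length (region P) (0, 1) <= projection_length (region P) u].

Definition D2 (R : realType) (v : R * R -> R) (u w p : R * R) : R :=
  'D_w ('D_u v) p.

(* Quantifying over all pairs of directions is the same as quantifying over the
   coordinate ones, since a C^2 function has continuous second derivatives
   D_w D_u v for all u and w. *)
Definition C2_on (R : realType) (U : set (R * R)) (v : R * R -> R) : Prop :=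
  forall (u w p : R * R), U p ->
    [/\ derivable v p u, derivable ('D_u v) p w & {for p, continuous (D2 v u w)}].

Definition laplacian (R : realType) (v : R * R -> R) (p : R * R) : R :=
  D2 v (1, 0) (1, 0) p + D2 v (0, 1) (0, 1) p.

(* Classical solution of the Dirichlet problem.  v is a total function, but
   only its values on the closure of A are constrained. *)
Definition torsion_function (R : realType) (A : set (R * R)) (v : R * R -> R) :
    Prop :=
  [/\ C2_on A° v,
      forall p, A° p -> laplacian v p = -1,
      {within closure A, continuous v}
    & forall p, (closure A `\` A°) p -> v p = 0].

Definition end_distance (R : realType) (P : profile R) (x : R) : R :=
  Num.min (x - pa P) (pb P - x).

Definition Error (R : realType) (c1 C1 : R) (P : profile R) (xt : R) : R :=
  C1 * expR (- c1 * end_distance P xt)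
  + C1 * sup [set expR (- c1 * `|x - xt|) * `|height P x - height P xt|
             | x in [set x | `|x - xt| <= 3 / 4 * end_distance P xt]].

Definition v1 (R : realType) (P : profile R) (p : R * R) : R :=
  2^-1 * (p.2 - f1 P p.1) * (f2 P p.1 - p.2).

(* For xt = a or xt = b the point (xt, y) lies on the boundary of the region,
   where v need not have a two-sided x-derivative; hence the guard on the
   second estimate. *)
Definition admissible (R : realType) (cstar c1 C1 : R) : Prop :=
  forall (P : profile R) (v : R * R -> R),
  normalised P -> torsion_function (region P) v ->
  forall xt, xt \in `[pa P, pb P] -> 2^-1 <= height P xt ->
  forall y, y \in `[f1 P xt + cstar, f2 P xt - cstar] ->
    `|v (xt, y) - v1 P (xt, y)| <= Error c1 C1 P xt
    /\ (pa P < xt < pb P -> `|'D_(1, 0) v (xt, y)| <= Error c1 C1 P xt).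

Definition property1 (R : realType) (c1 C1 : R) (P : profile R)
    (xbar M delta : R) : Prop :=
  [/\ `[xbar - M, xbar + M] `<=` `[pa P, pb P],
      0 <= delta
        <= 2^-1 * Num.min (1 - height P (xbar + M)) (1 - height P (xbar - M))
    & exists xm xp : R,
      [/\ xm \in `[xbar - M, xbar] /\ xp \in `[xbar, xbar + M],
          height P xm = 1 - 2 * delta,
          height P xp = 1 - 2 * delta
        & forall xt, xt \in `[xm, xp] -> Error c1 C1 P xt <= delta / 100]].

Definition is_max_point (R : realType) (A : set (R * R)) (v : R * R -> R)
    (p : R * R) : Prop :=
  A p /\ forall q, A q -> v q <= v p.

(* The open Euclidean disc; the product norm on R * R is the max norm. *)
Definition disc (R : realType) (p : R * R) (r : R) : set (R * R) :=
  [set q | (q.1 - p.1) ^+ 2 + (q.2 - p.2) ^+ 2 < r ^+ 2].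

(* Main.v *)
Require Import Defs.
From mathcomp Require Import all_boot all_order all_algebra.
From mathcomp Require Import all_classical all_reals all_analysis.
From mathcomp Require Import ring lra.
Import Order.TTheory GRing.Theory Num.Theory.
Import numFieldNormedType.Exports.
Local Open Scope classical_set_scope.
Local Open Scope ring_scope.
Set Implicit Arguments.
Unset Strict Implicit.

(** Write h for the height function, d for the small parameter, and Q for the
    rectangle [x_-, x_+] x [1/5, 4/5].  On Q the domain looks like the strip
    0 <= y <= 1, whose torsion function is y (1 - y) / 2, and three facts
    determine the Hessian of v there.

    - |v_x| <= d / 100 on Q: this is what the bound on [Error] says.  Since v_x
      is harmonic, interior gradient estimates bound |v_xx| and |v_xy| by K d
      on a smaller rectangle, where v_yy = -1 - v_xx is then close to -1.
    - sqrt v is concave ([sqrt_torsion_concave]).  Hence 2 v v_xx <= v_x ^ 2,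
      and v_xx is at most d ^ 2 / 200 on Q ([as_concave]).
    - v at the centre exceeds v near the two ends of Q by 3 d / 10
      ([as_drop]), because h drops from 1 to 1 - 2 d.  By the mean value
      theorem v_xx <= - kappa d at some point ([as_curvature_point]).

    So d ^ 2 / 200 - v_xx is a nonnegative harmonic function that is of order d
    at one point.  Harnack's inequality makes it of order d on the whole
    smaller rectangle, and for small d this leaves v_xx <= - c d there.  In

      - D_n ^ 2 v = - (n_1 ^ 2 v_xx + 2 n_1 n_2 v_xy + n_2 ^ 2 v_yy)

    the first coefficient is of order d, the last one is close to 1 and the
    mixed one is at most of order d; completing the square gives the two bounds
    ([quadratic_form_bounds], [hessian_bounds_flat]).

    It remains to see that the maximum point is well inside Q.  The maximum is
    at least 1/8 - d / 100, whereas v <= y (1 - y) / 2 everywhere and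
    v <= h ^ 2 / 8 + d / 100 on Q; so at the height 1 - 2 d the function is
    smaller than at the centre and at the maximum point, and by the concavity
    of sqrt v the segment between these two points does not meet the lines
    x = x_- and x = x_+ ([as_max_location]).  The height at the maximum point
    is thus at least 1 - d, and as the slopes of h are at most H d for a number
    H that depends only on M and the constants in [Error], the distance to those
    lines is at least 1 / H ([as_margin]).

    A torsion function is by definition only of class C ^ 2, so v_x and
    v_xx are replaced by the differences v (x + s, y) - v (x, y) and
    v (x + s, y) + v (x - s, y) - 2 v (x, y).  They are harmonic in the sense
    that their five-point difference quotients tend to 0, because this form of
    the Laplacian commutes with translations; s tends to 0 only at the end.
    The minimum principle holds for this Laplacian and continuous functions,
    and it is the only tool: the gradient estimate and Harnack's inequality
    come from explicit polynomial barriers ([harmonic_difference_le],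
    [positivity_spread]), and the concavity of sqrt v from a minimum of the
    concavity defect over pairs of points. *)

(** [lra] on the order hypotheses alone: discarding the other ones and the
    bodies of local definitions keeps its preprocessing short. *)
Ltac linear :=
  repeat match goal with
  | H : ?T |- _ =>
      lazymatch T with
      | is_true _ => fail
      | @eq _ _ _ => fail
      | _ => lazymatch type of T with Prop => clear H end
      end
  end;
  repeat match goal with x := _ |- _ => clearbody x end;
  lra.

(** * Continuity of polynomial expressions *)

Lemma continuous_fctD (T : topologicalType) (R : realType) (f g : T -> R) :
  continuous f -> continuous g -> continuous (fun q => f q + g q).
Proof. by move=> cf cg q; apply: cvgD; [exact: cf|exact: cg]. Qed.

Lemma continuous_fctN (T : topologicalType) (R : realType) (f : T -> R) :
  continuous f -> continuous (fun q => - f q).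
Proof. by move=> cf q; apply: cvgN; exact: cf. Qed.

Lemma continuous_fctM (T : topologicalType) (R : realType) (f g : T -> R) :
  continuous f -> continuous g -> continuous (fun q => f q * g q).
Proof. by move=> cf cg q; apply: cvgM; [exact: cf|exact: cg]. Qed.

Lemma continuous_fctX (T : topologicalType) (R : realType) n (f : T -> R) :
  continuous f -> continuous (fun q => f q ^+ n).
Proof.
move=> cf q; apply: (@continuous_comp _ _ _ f (fun x : R => x ^+ n)).
  exact: cf.
exact: exprn_continuous.
Qed.

Lemma continuous_fst (S T : topologicalType) : continuous (fun q : S * T => q.1).
Proof. by move=> q; exact: cvg_fst. Qed.

Lemma continuous_snd (S T : topologicalType) : continuous (fun q : S * T => q.2).
Proof. by move=> q; exact: cvg_snd. Qed.

(** Proves the continuity of a polynomial expression in the two coordinates of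
    a point of the plane, by recursion on its syntax. *)
Ltac continuous_polynomial :=
  lazymatch goal with
  | |- continuous (fun q => q) => move=> q; exact: cvg_id
  | |- continuous (fun _ => ?c) => exact: cst_continuous
  | |- continuous fst => exact: continuous_fst
  | |- continuous snd => exact: continuous_snd
  | |- continuous (fun q => q.1) => exact: continuous_fst
  | |- continuous (fun q => q.2) => exact: continuous_snd
  | |- continuous (fun q => GRing.add (@?f q) (@?g q)) =>
      apply: (@continuous_fctD _ _ f g); continuous_polynomial
  | |- continuous (fun q => GRing.opp (@?f q)) =>
      apply: (@continuous_fctN _ _ f); continuous_polynomial
  | |- continuous (fun q => GRing.mul (@?f q) (@?g q)) =>
      apply: (@continuous_fctM _ _ f g); continuous_polynomial
  | |- continuous (fun q => GRing.exp (@?f q) ?n) =>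
      apply: (@continuous_fctX _ _ n f); continuous_polynomial
  end.

(** * The five-point Laplacian *)

Definition stencil (R : realType) (w : R * R -> R) (p : R * R) (s : R) : R :=
  w (p.1 + s, p.2) + w (p.1 - s, p.2) + w (p.1, p.2 + s) + w (p.1, p.2 - s)
  - 4 * w p.

(** The Laplacian as the limit of five-point difference quotients: unlike the sum
    of two second derivatives, it makes sense for continuous functions and
    visibly commutes with translations, reflections and dilations. *)
Definition has_laplacian (R : realType) (w : R * R -> R) (p : R * R) (k : R) :
    Prop :=
  stencil w p s / s ^+ 2 @[s --> 0^'+] --> k.

Lemma has_laplacian_lin (R : realType) (w1 w2 : R * R -> R) p k1 k2 (a b : R) :
  has_laplacian w1 p k1 -> has_laplacian w2 p k2 ->
  has_laplacian (fun q => a * w1 q + b * w2 q) p (a * k1 + b * k2).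
Proof.
move=> h1 h2; rewrite /has_laplacian.
have -> : (fun s => stencil (fun q => a * w1 q + b * w2 q) p s / s ^+ 2) =
  (fun s => a * (stencil w1 p s / s ^+ 2) + b * (stencil w2 p s / s ^+ 2)).
  by apply/funext => s; rewrite /stencil; ring.
by apply: cvgD; apply: cvgM => //; exact: cvg_cst.
Qed.

Arguments has_laplacian_lin {R w1 w2 p k1 k2} a b.

Lemma has_laplacian_shift (R : realType) (w : R * R -> R) (p : R * R) a b k :
  has_laplacian w (p.1 + a, p.2 + b) k ->
  has_laplacian (fun q => w (q.1 + a, q.2 + b)) p k.
Proof.
rewrite /has_laplacian.
have -> : stencil (fun q => w (q.1 + a, q.2 + b)) p =
    stencil w (p.1 + a, p.2 + b).
  apply/funext => s; rewrite /stencil /=.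
  by rewrite !(addrAC _ s) !(addrAC _ (- s)).
by [].
Qed.

Lemma has_laplacian_reflect (R : realType) (w : R * R -> R) (p : R * R) a k :
  has_laplacian w (a - p.1, p.2) k ->
  has_laplacian (fun q => w (a - q.1, q.2)) p k.
Proof.
rewrite /has_laplacian.
have -> : stencil (fun q => w (a - q.1, q.2)) p = stencil w (a - p.1, p.2).
  apply/funext => s; rewrite /stencil /=.
  rewrite (_ : a - (p.1 + s) = a - p.1 - s); last by ring.
  by rewrite (_ : a - (p.1 - s) = a - p.1 + s); ring.
by [].
Qed.

Lemma has_laplacian_swap (R : realType) (w : R * R -> R) (p : R * R) k :
  has_laplacian w (p.2, p.1) k ->
  has_laplacian (fun q => w (q.2, q.1)) p k.
Proof.
rewrite /has_laplacian.
have -> : stencil (fun q => w (q.2, q.1)) p = stencil w (p.2, p.1).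
  by apply/funext => s; rewrite /stencil /=; ring.
by [].
Qed.

Lemma cvg_scale_at_right (R : realType) (t : R) : 0 < t ->
  (s * t) @[s --> 0^'+] --> (0 : R)^'+.
Proof.
move=> t0 A /= [e /= e0 eA]; exists (e / t) => /=; first by rewrite divr_gt0.
move=> s /=; rewrite sub0r normrN => se s0; apply: eA; last by rewrite mulr_gt0.
by rewrite /= sub0r normrN normrM (gtr0_norm t0) -ltr_pdivlMr.
Qed.

Lemma has_laplacian_scale (R : realType) (w : R * R -> R) (p : R * R) k (t : R) :
  0 < t -> has_laplacian w p k ->
  stencil w p (s * t) / s ^+ 2 @[s --> 0^'+] --> t ^+ 2 * k.
Proof.
move=> t0 h.
have -> : (fun s => stencil w p (s * t) / s ^+ 2) =
    (fun s => t ^+ 2 * (stencil w p (s * t) / (s * t) ^+ 2)).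
  apply/funext => s; have [->|s0] := eqVneq s 0.
    by rewrite mul0r !expr0n /= invr0 !mulr0.
  by field; rewrite s0 gt_eqF.
apply: cvgM; first exact: cvg_cst.
exact: (cvg_comp _ _ (cvg_scale_at_right t0) h).
Qed.

Lemma cvg_quadratic_at0 (R : realType) (k c : R) :
  k + c * s ^+ 2 @[s --> (0:R)^'+] --> k.
Proof.
apply: cvg_at_right_filter.
have h : k + c * (0 : R) ^+ 2 = k by rewrite expr0n /= mulr0 addr0.
rewrite -[X in _ --> X]h; apply: cvgD; first exact: cvg_cst.
by apply: cvgM; [exact: cvg_cst|exact: exprn_continuous].
Qed.

(** For the barriers, which are polynomials of degree at most four: the stencil
    of such a polynomial has only terms of degrees two and four in the step. *)
Lemma has_laplacian_poly (R : realType) (w : R * R -> R) (p : R * R) (k c : R) :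
  (forall s, stencil w p s = s ^+ 2 * (k + c * s ^+ 2)) -> has_laplacian w p k.
Proof.
move=> h; have H : {near 0^'+, (fun s => k + c * s ^+ 2) =1
    (fun s => stencil w p s / s ^+ 2)}.
  near=> s; have s0 : s != 0 by rewrite gt_eqF//; near: s; exact: nbhs_right_gt.
  by rewrite h; field.
rewrite /has_laplacian; apply: cvg_trans; first exact: (near_eq_cvg H).
exact: cvg_quadratic_at0.
Unshelve. all: by end_near. Qed.

Lemma cvg_at_right_ge0 (R : realType) (f : R -> R) (l : R) :
  f s @[s --> 0^'+] --> l -> (\forall s \near 0^'+, 0 <= f s) -> 0 <= l.
Proof.
move=> fl f0; rewrite -(cvg_lim _ fl)//.
by apply: limr_ge => //; apply/cvg_ex; exists l.
Qed.

Lemma has_laplacian_ge0 (R : realType) (w : R * R -> R) (p : R * R) k :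
  has_laplacian w p k -> (\forall s \near 0^'+, 0 <= stencil w p s) -> 0 <= k.
Proof.
move=> h st; apply: (cvg_at_right_ge0 h); near=> s.
by rewrite mulr_ge0 ?invr_ge0 ?sqr_ge0//; near: s.
Unshelve. all: by end_near. Qed.

Lemma near_shift_interior (R : realType) (K : set (R * R)) (p : R * R) :
  K° p -> \forall s \near (0:R)^'+,
    [/\ K (p.1 + s, p.2), K (p.1 - s, p.2), K (p.1, p.2 + s) & K (p.1, p.2 - s)].
Proof.
move=> /nbhs_ballP[e /= e0 eK]; near=> s.
have s0 : 0 < s by near: s; exact: nbhs_right_gt.
have se : s < e by near: s; exact: nbhs_right_lt.
split; apply: eK; split => /=; rewrite /ball /=;
  by rewrite ?subrr ?normr0 // ?opprD ?opprK ?addNKr ?addKr ?addrA ?subrr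
    ?sub0r ?add0r ?normrN ?gtr0_norm.
Unshelve. all: by end_near. Qed.

(** * The minimum principle *)

Lemma within_continuousD (T : topologicalType) (R : realType) (K : set T)
    (f g : T -> R) :
  {within K, continuous f} -> {within K, continuous g} ->
  {within K, continuous (fun x => f x + g x)}.
Proof. by move=> cf cg x; apply: cvgD; [exact: cf|exact: cg]. Qed.

Lemma within_continuousM (T : topologicalType) (R : realType) (K : set T)
    (f g : T -> R) :
  {within K, continuous f} -> {within K, continuous g} ->
  {within K, continuous (fun x => f x * g x)}.
Proof. by move=> cf cg x; apply: cvgM; [exact: cf|exact: cg]. Qed.

Lemma compact_minimum (T : topologicalType) (R : realType) (K : set T)
    (g : T -> R) :
  K !=set0 -> compact K -> {within K, continuous g} ->
  exists2 c : T, K c & forall q, K q -> g c <= g q.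
Proof.
move=> K0 cK cg; have [c /set_mem Kc cmin] := compact_EVT_min K0 cK cg.
by exists c => // q /mem_set; exact: cmin.
Qed.

(** Adding e (B - x ^ 2) makes the inequality for the Laplacian strict: at an
    interior minimum of w + e (B - x ^ 2) the Laplacian of this function is at
    most -2 e, whereas the stencil at a minimum is nonnegative. *)
Lemma minimum_principle (R : realType) (K : set (R * R)) (w : R * R -> R) :
  compact K ->
  {within K, continuous w} ->
  (forall p, K p -> 0 <= w p \/ K° p /\ exists2 k : R, k <= 0 & has_laplacian w p k) ->
  forall p, K p -> 0 <= w p.
Proof.
move=> cK cw Kw p0 Kp0.
have [B KB] : exists B : R, forall p, K p -> p.1 ^+ 2 <= B.
  have [|c Kc cmin] := @compact_minimum _ R K (fun q => - q.1 ^+ 2)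
      (ex_intro _ p0 Kp0) cK.
    by apply: continuous_subspaceT; continuous_polynomial.
  by exists (c.1 ^+ 2) => q /cmin; rewrite lerN2.
move: p0 Kp0; suff H (e : R) : 0 < e -> forall p, K p -> 0 <= w p + e * (B - p.1 ^+ 2).
  move=> p Kp; rewrite leNgt; apply/negP => wp.
  have B0 : 0 < B - p.1 ^+ 2 + 1 by have := KB _ Kp; linear.
  have e0 : 0 < - w p / 2 / (B - p.1 ^+ 2 + 1) by rewrite !divr_gt0// oppr_gt0.
  have := H _ e0 _ Kp; set e := (X in X * _).
  have : e * (B - p.1 ^+ 2) = - w p / 2 - e by rewrite /e; field; rewrite gt_eqF.
  move=> ->; have : 0 < e by []. linear.
move=> e0 p Kp; pose g (q : R * R) := 1 * w q + e * (B - q.1 ^+ 2).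
have cg : {within K, continuous g}.
  apply: within_continuousD; first by apply: within_continuousM => // q; exact: cvg_cst.
  by apply: continuous_subspaceT; continuous_polynomial.
have [c Kc cmin] := compact_minimum (ex_intro _ p Kp) cK cg.
suff gc : 0 <= g c.
  by have := le_trans gc (cmin p Kp); rewrite /g mul1r.
have [wc|[iK [k k0 wk]]] := Kw _ Kc.
  by rewrite /g mul1r addr_ge0// mulr_ge0 ?(ltW e0)// subr_ge0 KB.
have h2 : has_laplacian (fun q : R * R => B - q.1 ^+ 2) c (-2).
  by apply: (@has_laplacian_poly _ _ _ _ 0) => s; rewrite /stencil /=; ring.
exfalso; have : \forall s \near 0^'+, 0 <= stencil g c s; last first.
  move=> /(has_laplacian_ge0 (has_laplacian_lin 1 e wk h2)).
  by apply/negP; rewrite -ltNge; linear.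
near=> s; rewrite /stencil.
have [h1' h2' h3 h4] : [/\ K (c.1 + s, c.2), K (c.1 - s, c.2), K (c.1, c.2 + s) & K (c.1, c.2 - s)].
  by near: s; exact: near_shift_interior.
have := cmin _ h1'; have := cmin _ h2'.
have := cmin _ h3; have := cmin _ h4.
linear.
Unshelve. all: by end_near. Qed.

(** * Differences of bounded harmonic functions *)

Definition harmonic_at (R : realType) (q : R * R -> R) (p : R * R) : Prop :=
  {for p, continuous q} /\ has_laplacian q p 0.

Lemma harmonic_at_lin (R : realType) (f g : R * R -> R) p (a b : R) :
  harmonic_at f p -> harmonic_at g p ->
  harmonic_at (fun q => a * f q + b * g q) p.
Proof.
move=> [cf hf] [cg hg]; split.
  apply: cvgD; (apply: cvgM; first exact: cvg_cst); [exact: cf|exact: cg].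
by have := has_laplacian_lin a b hf hg; rewrite !mulr0 addr0.
Qed.

Lemma continuous_fctpair (S T U : topologicalType) (f : S -> T) (g : S -> U) :
  continuous f -> continuous g -> continuous (fun q => (f q, g q)).
Proof. by move=> cf cg q; exact: cvg_pair (cf q) (cg q). Qed.

Lemma harmonic_at_shift (R : realType) (f : R * R -> R) (p : R * R) a b :
  harmonic_at f (p.1 + a, p.2 + b) ->
  harmonic_at (fun q => f (q.1 + a, q.2 + b)) p.
Proof.
move=> [cf hf]; split; last exact: has_laplacian_shift.
apply: (@continuous_comp _ _ _ (fun q : R * R => (q.1 + a, q.2 + b)) f) => //.
by apply: continuous_fctpair; continuous_polynomial.
Qed.

Lemma harmonic_at_reflect (R : realType) (f : R * R -> R) (p : R * R) a :
  harmonic_at f (a - p.1, p.2) ->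
  harmonic_at (fun q => f (a - q.1, q.2)) p.
Proof.
move=> [cf hf]; split; last exact: has_laplacian_reflect.
apply: (@continuous_comp _ _ _ (fun q : R * R => (a - q.1, q.2)) f) => //.
by apply: continuous_fctpair; continuous_polynomial.
Qed.

Lemma harmonic_at_swap (R : realType) (f : R * R -> R) (p : R * R) :
  harmonic_at f (p.2, p.1) -> harmonic_at (fun q => f (q.2, q.1)) p.
Proof.
move=> [cf hf]; split; last exact: has_laplacian_swap.
apply: (@continuous_comp _ _ _ (fun q : R * R => (q.2, q.1)) f) => //.
by apply: continuous_fctpair; continuous_polynomial.
Qed.

Definition box (R : realType) (c : R * R) (d : R) : set (R * R) :=
  [set p | `|p.1 - c.1| <= d /\ `|p.2 - c.2| <= d].

Lemma compact_rectangle (R : realType) (a b c d : R) :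
  compact [set p : R * R | (a <= p.1 <= b) /\ (c <= p.2 <= d)].
Proof.
have := compact_setX (@segment_compact R a b) (@segment_compact R c d).
congr compact; apply/seteqP; split => p /=; rewrite !in_itv /=; tauto.
Qed.

Lemma interior_rectangle (R : realType) (a b c d : R) (p : R * R) :
  a < p.1 < b -> c < p.2 < d ->
  [set p : R * R | (a <= p.1 <= b) /\ (c <= p.2 <= d)]° p.
Proof.
move=> /andP[h1 h2] /andP[h3 h4]; rewrite /interior /=.
exists (`]a, b[%classic, `]c, d[%classic).
  by split; apply: near_in_itvoo; rewrite in_itv /= ?h1 ?h3.
move=> q [] /=; rewrite !in_itv /=.
by move=> /andP[/ltW-> /ltW->] /andP[/ltW-> /ltW->].
Qed.

(** Let (X, Y) be the coordinates centred at c.  The function q (p) - q (p'),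
    with p' the mirror image of p in the line X = 0, vanishes on this line and
    is at most 2 N.  The harmonic barrier
    2 N ((Y ^ 2 - X ^ 2) / d ^ 2 + 2 X / d) is nonnegative on the half box
    0 <= X <= d and at least 2 N on its three other sides; the minimum principle
    compares the two, and the claim is the comparison on the axis Y = 0. *)
Lemma harmonic_difference_le (R : realType) (q : R * R -> R) (c : R * R) (d N s : R) :
  0 < d -> (forall p, box c d p -> harmonic_at q p /\ `|q p| <= N) ->
  0 <= s <= d -> q (c.1 + s, c.2) - q (c.1 - s, c.2) <= 4 * N / d * s.
Proof.
move=> d0 Hq /andP[s0 sd].
pose K := [set p : R * R | (c.1 <= p.1 <= c.1 + d) /\ (c.2 - d <= p.2 <= c.2 + d)].
pose B (p : R * R) := 2 * N * ((((p.2 - c.2) ^+ 2 - (p.1 - c.1) ^+ 2) / d ^+ 2)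
  + 2 * (p.1 - c.1) / d).
pose w p := 1 * B p + (-1) * (1 * q p + (-1) * q ((c.1 + c.1) - p.1, p.2)).
have KB p : K p -> box c d p.
  by rewrite /box /= => -[/andP[h1 h2] /andP[h3 h4]]; split; rewrite ler_norml; linear.
have KB' p : K p -> box c d ((c.1 + c.1) - p.1, p.2).
  by rewrite /box /= => -[/andP[h1 h2] /andP[h3 h4]]; split; rewrite ler_norml; linear.
have N0 : 0 <= N.
  have [] := Hq c; first by rewrite /box /= !subrr normr0 (ltW d0).
  by move=> _; apply: le_trans.
have harm p : K p -> harmonic_at (fun p => 1 * q p + (-1) * q ((c.1 + c.1) - p.1, p.2)) p.
  move=> Kp; apply: harmonic_at_lin; first by have [] := Hq p (KB p Kp).
  by apply: harmonic_at_reflect; have [] := Hq _ (KB' p Kp).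
have cw : {within K, continuous w}.
  apply: within_continuousD.
    by apply: continuous_subspaceT; rewrite /B; continuous_polynomial.
  apply: within_continuousM; first by move=> ?; exact: cvg_cst.
  apply: continuous_in_subspaceT => p /set_mem /harm []. by [].
have Bge p : K p -> 0 <= B p.
  move=> [/andP[h1 h2] /andP[h3 h4]].
  rewrite /B mulr_ge0 ?mulr_ge0//.
  have -> : ((p.2 - c.2) ^+ 2 - (p.1 - c.1) ^+ 2) / d ^+ 2 + 2 * (p.1 - c.1) / d =
    ((p.2 - c.2) ^+ 2 + (p.1 - c.1) * (2 * d - (p.1 - c.1))) / d ^+ 2.
    by field; rewrite gt_eqF.
  by rewrite divr_ge0 ?sqr_ge0// addr_ge0 ?sqr_ge0// mulr_ge0; linear.
have Bbig p : K p -> (d ^+ 2 <= (p.2 - c.2) ^+ 2 \/ p.1 = c.1 + d) -> 2 * N <= B p.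
  move=> [/andP[h1 h2] /andP[h3 h4]] h.
  rewrite /B -[leLHS]mulr1 ler_wpM2l ?mulr_ge0//.
  have -> : ((p.2 - c.2) ^+ 2 - (p.1 - c.1) ^+ 2) / d ^+ 2 + 2 * (p.1 - c.1) / d =
    ((p.2 - c.2) ^+ 2 + (p.1 - c.1) * (2 * d - (p.1 - c.1))) / d ^+ 2.
    by field; rewrite gt_eqF.
  rewrite ler_pdivlMr ?exprn_gt0// mul1r.
  case: h => [h|->].
    by rewrite -[leLHS]addr0 lerD// mulr_ge0; linear.
  rewrite (_ : (_ + d - _) * _ = d ^+ 2); last by ring.
  by rewrite lerDr sqr_ge0.
have qN p : K p -> 1 * q p + (-1) * q ((c.1 + c.1) - p.1, p.2) <= 2 * N.
  move=> Kp; have [_] := Hq _ (KB p Kp); have [_] := Hq _ (KB' p Kp).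
  by rewrite !ler_norml; linear.
have wK : forall p, K p -> 0 <= w p.
  apply: (minimum_principle (@compact_rectangle _ _ _ _ _) cw) => p Kp.
  have [h1|h1] := eqVneq p.1 c.1.
    left; rewrite /w; have := Bge p Kp.
    have -> : c.1 + c.1 - p.1 = p.1 by rewrite h1; ring.
    rewrite -surjective_pairing; linear.
  have [h2|h2] := eqVneq p.1 (c.1 + d).
    by left; rewrite /w; have := Bbig p Kp (or_intror h2); have := qN p Kp; linear.
  have [h3|h3] := eqVneq p.2 (c.2 + d).
    left; rewrite /w; have := Bbig p Kp; have := qN p Kp; rewrite h3 => h4 h5.
    suff : 2 * N <= B p by linear.
    by apply: h5; left; rewrite addrAC subrr add0r.
  have [h4|h4] := eqVneq p.2 (c.2 - d).
    left; rewrite /w; have := Bbig p Kp; have := qN p Kp; rewrite h4 => h5 h6.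
    suff : 2 * N <= B p by linear.
    by apply: h6; left; rewrite addrAC subrr add0r sqrrN.
  have [/andP[k1 k2] /andP[k3 k4]] := Kp.
  right; split.
    apply: interior_rectangle; rewrite !lt_neqAle.
      by rewrite eq_sym h1 h2 k1 k2.
    by rewrite eq_sym h4 h3 k3 k4.
  exists 0 => //; rewrite -[X in has_laplacian _ _ X](_ : 1 * 0 + (-1) * 0 = 0);
    last by rewrite !mulr0 addr0.
  apply: has_laplacian_lin; last by have [] := harm p Kp.
  apply: (@has_laplacian_poly _ _ _ _ 0) => t; rewrite /stencil /B /=; field.
  by rewrite gt_eqF.
have := wK (c.1 + s, c.2); rewrite /w /B /=.
have -> : c.1 + c.1 - (c.1 + s) = c.1 - s by ring.
have -> : (c.2 - c.2) ^+ 2 - (c.1 + s - c.1) ^+ 2 = - s ^+ 2 by ring.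
have -> : c.1 + s - c.1 = s by ring.
have Ks : K (c.1 + s, c.2) by split => /=; linear.
move=> /(_ Ks); have : 0 <= 2 * N * (s ^+ 2 / d ^+ 2).
  by apply: mulr_ge0; [rewrite mulr_ge0|rewrite divr_ge0 ?sqr_ge0].
rewrite mulNr mulrDr (_ : 2 * N * (2 * s / d) = 4 * N / d * s); last by field; rewrite gt_eqF.
linear.
Qed.

Lemma harmonic_atN (R : realType) (f : R * R -> R) p :
  harmonic_at f p -> harmonic_at (fun q => - f q) p.
Proof.
move=> h; have := harmonic_at_lin (-1) 0 h h.
by congr (harmonic_at _ p); apply/funext => q; rewrite mul0r addr0 mulN1r.
Qed.

Lemma harmonic_difference_bound (R : realType) (q : R * R -> R) (c : R * R) (d N s : R) :
  0 < d -> (forall p, box c d p -> harmonic_at q p /\ `|q p| <= N) ->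
  `|s| <= d -> `|q (c.1 + s, c.2) - q (c.1 - s, c.2)| <= 4 * N / d * `|s|.
Proof.
move=> d0 Hq; wlog s0 : s / 0 <= s => [H sd|sd].
  have [/H|s0] := leP 0 s; first exact.
  have := H (- s); rewrite normrN opprK distrC => -> //; linear.
rewrite ger0_norm// in sd *; rewrite ler_norml; apply/andP; split; last first.
  by apply: harmonic_difference_le => //; rewrite s0.
have := @harmonic_difference_le _ (fun q' => - q q') c d N s d0.
rewrite s0 sd => H; have := H _ isT; rewrite -subr_ge0 => H1.
rewrite -subr_ge0 (_ : _ - - _ = 4 * N / d * s - (- q (c.1 + s, c.2) - - q (c.1 - s, c.2))).
  by apply: H1 => p /Hq[/harmonic_atN h1 h2]; rewrite normrN.
ring.
Qed.

Lemma harmonic_difference_bound_vertical (R : realType) (q : R * R -> R)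
    (c : R * R) (d N s : R) :
  0 < d -> (forall p, box c d p -> harmonic_at q p /\ `|q p| <= N) ->
  `|s| <= d -> `|q (c.1, c.2 + s) - q (c.1, c.2 - s)| <= 4 * N / d * `|s|.
Proof.
move=> d0 Hq sd.
apply: (@harmonic_difference_bound _ (fun p => q (p.2, p.1)) (c.2, c.1) d N s) => //.
move=> p [/= h1 h2]; have [h3 h4] := Hq (p.2, p.1) (conj h2 h1).
by split=> //; exact: harmonic_at_swap.
Qed.

(** * Propagation of positivity of harmonic functions *)

Definition dist2 (R : realType) (c p : R * R) : R :=
  (p.1 - c.1) ^+ 2 + (p.2 - c.2) ^+ 2.

Lemma sqr_le_abs (R : realType) (x y : R) : 0 <= y -> x ^+ 2 <= y ^+ 2 -> `|x| <= y.
Proof.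
move=> y0 h; rewrite -(@ler_pXn2r _ 2) ?nnegrE//.
by rewrite real_normK// num_real.
Qed.

Lemma dist2_continuous (R : realType) (c : R * R) : continuous (dist2 c).
Proof. by rewrite /dist2; continuous_polynomial. Qed.

(** The barrier (2 - dist2 c p / r ^ 2) ^ 2 is 1 on the inner circle and 0 on the
    outer one, and its Laplacian 16 (dist2 c p - r ^ 2) / r ^ 4 is nonnegative in
    between. *)
Lemma positivity_spread (R : realType) (U : R * R -> R) (c : R * R) (r m : R) :
  0 < r -> 0 <= m ->
  (forall p, dist2 c p <= 2 * r ^+ 2 -> harmonic_at U p /\ 0 <= U p) ->
  (forall p, dist2 c p <= r ^+ 2 -> m <= U p) ->
  forall p, r ^+ 2 <= dist2 c p <= 2 * r ^+ 2 ->
    m * (2 - dist2 c p / r ^+ 2) ^+ 2 <= U p.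
Proof.
move=> r0 m0 UH Um.
pose K := [set p | r ^+ 2 <= dist2 c p <= 2 * r ^+ 2].
pose b p := (2 - dist2 c p / r ^+ 2) ^+ 2.
have cb : continuous b.
  by rewrite /b /dist2; continuous_polynomial.
have r20 : 0 < r ^+ 2 by rewrite exprn_gt0.
suff wK : forall p, K p -> 0 <= 1 * U p + (- m) * b p.
  by move=> p Kp; have := wK p Kp; rewrite /b; linear.
apply: minimum_principle.
- apply: (subclosed_compact _ (@compact_rectangle _ (c.1 - 2 * r) (c.1 + 2 * r)
    (c.2 - 2 * r) (c.2 + 2 * r))).
    have -> : K = dist2 c @^-1` `[r ^+ 2, 2 * r ^+ 2]%classic.
      by apply/seteqP; split => p /=; rewrite in_itv.
    apply: closed_comp; last exact: itv_closed.
    by move=> p _; exact: dist2_continuous.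
  move=> p /andP[_]; rewrite /dist2 => h.
  have h1 : (p.1 - c.1) ^+ 2 <= (2 * r) ^+ 2.
    by rewrite exprMn; have := sqr_ge0 (p.2 - c.2); linear.
  have h2 : (p.2 - c.2) ^+ 2 <= (2 * r) ^+ 2.
    by rewrite exprMn; have := sqr_ge0 (p.1 - c.1); linear.
  have r20' : 0 <= 2 * r by linear.
  have := sqr_le_abs r20' h1; have := sqr_le_abs r20' h2.
  by rewrite !ler_norml => ? ?; split; linear.
- apply: within_continuousD.
    apply: within_continuousM; first by move=> ?; exact: cvg_cst.
    by apply: continuous_in_subspaceT => p /set_mem/andP[_ /UH[[]]].
  apply: within_continuousM; first by move=> ?; exact: cvg_cst.
  exact: continuous_subspaceT.
- move=> p /andP[h1 h2].
  have [e1|e1] := eqVneq (dist2 c p) (r ^+ 2).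
    left; rewrite /b e1 divff ?gt_eqF//.
    by have := Um p; rewrite e1 lexx => /(_ isT); linear.
  have [e2|e2] := eqVneq (dist2 c p) (2 * r ^+ 2).
    left; rewrite /b e2 mulfK ?gt_eqF// subrr expr0n /= mulr0 addr0 mul1r.
    by have [] := UH p h2.
  right; split.
    have pI : dist2 c p \in `]r ^+ 2, 2 * r ^+ 2[.
      by rewrite in_itv /= !lt_neqAle h1 h2 e2 eq_sym e1.
    have nI : nbhs p [set q | dist2 c q \in `]r ^+ 2, 2 * r ^+ 2[] :=
      @dist2_continuous _ c p _ (near_in_itvoo pI).
    rewrite /interior /=; apply: filterS nI => q /=; rewrite in_itv /K /=.
    by move=> /andP[/ltW-> /ltW->].
  exists (1 * 0 + - m * ((16 * dist2 c p - 16 * r ^+ 2) / r ^+ 4)).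
    rewrite mulr0 add0r mulNr oppr_le0 mulr_ge0// divr_ge0 ?exprn_ge0 ?(ltW r0)//.
    by rewrite -mulrBr mulr_ge0 ?subr_ge0.
  apply: has_laplacian_lin; first by have [[]] := UH p h2.
  apply: (@has_laplacian_poly _ _ _ _ (4 / r ^+ 4)) => t.
  by rewrite /stencil /b /dist2 /=; field; rewrite gt_eqF.
Qed.

(** The disc of radius r about c + w lies in the disc of radius 6 r / 5 about c,
    where the barrier of [positivity_spread] is at least
    (2 - 36 / 25) ^ 2 = (14 / 25) ^ 2 > 3 / 10. *)
Lemma positivity_step (R : realType) (U : R * R -> R) (c w : R * R) (r m : R) :
  0 < r -> 0 <= m -> w.1 ^+ 2 + w.2 ^+ 2 <= (r / 5) ^+ 2 ->
  (forall p, dist2 c p <= 2 * r ^+ 2 -> harmonic_at U p /\ 0 <= U p) ->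
  (forall p, dist2 c p <= r ^+ 2 -> m <= U p) ->
  forall p, dist2 (c.1 + w.1, c.2 + w.2) p <= r ^+ 2 -> 3 / 10 * m <= U p.
Proof.
move=> r0 m0 wr UH Um p; rewrite /dist2 /= => pw.
have r20 : 0 < r ^+ 2 by rewrite exprn_gt0.
have pd : dist2 c p <= 36 / 25 * r ^+ 2.
  (* the triangle inequality for r + r / 5, in squared form *)
  rewrite /dist2.
  have h1 := sqr_ge0 (p.1 - (c.1 + w.1) - 5 * w.1).
  have h2 := sqr_ge0 (p.2 - (c.2 + w.2) - 5 * w.2).
  have -> : (p.1 - c.1) ^+ 2 + (p.2 - c.2) ^+ 2 =
    6 / 5 * ((p.1 - (c.1 + w.1)) ^+ 2 + (p.2 - (c.2 + w.2)) ^+ 2) +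
    6 * (w.1 ^+ 2 + w.2 ^+ 2) - ((p.1 - (c.1 + w.1) - 5 * w.1) ^+ 2
     + (p.2 - (c.2 + w.2) - 5 * w.2) ^+ 2) / 5.
    by field.
  have -> : 36 / 25 * r ^+ 2 = 6 / 5 * r ^+ 2 + 6 * (r / 5) ^+ 2 by field.
  linear.
have [h|h] := leP (dist2 c p) (r ^+ 2); first by have := Um p h; linear.
have pK : r ^+ 2 <= dist2 c p <= 2 * r ^+ 2 by rewrite (ltW h); linear.
apply: le_trans (positivity_spread r0 m0 UH Um pK).
rewrite mulrC ler_wpM2l//.
have h3 : dist2 c p / r ^+ 2 <= 36 / 25 by rewrite ler_pdivrMr.
have h4 : 14 / 25 <= 2 - dist2 c p / r ^+ 2 by linear.
have : (14 / 25) ^+ 2 <= (2 - dist2 c p / r ^+ 2) ^+ 2.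
  by rewrite lerXn2r ?nnegrE//; linear.
linear.
Qed.

(** Harnack's inequality along a chain of discs. *)
Lemma positivity_chain (R : realType) (U : R * R -> R) (c w : R * R) (r m : R)
    (N : nat) :
  0 < r -> 0 <= m -> w.1 ^+ 2 + w.2 ^+ 2 <= (r / 5) ^+ 2 ->
  (forall k p, (k < N)%N ->
    dist2 (c.1 + k%:R * w.1, c.2 + k%:R * w.2) p <= 2 * r ^+ 2 ->
    harmonic_at U p /\ 0 <= U p) ->
  (forall p, dist2 c p <= r ^+ 2 -> m <= U p) ->
  forall p, dist2 (c.1 + N%:R * w.1, c.2 + N%:R * w.2) p <= r ^+ 2 ->
    (3 / 10) ^+ N * m <= U p.
Proof.
move=> r0 m0 wr; elim: N => [|N IH] UH Um p.
  by rewrite expr0 mul1r !mul0r !addr0 => /Um.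
move=> h; rewrite exprS -mulrA.
apply: (positivity_step (c := (c.1 + N%:R * w.1, c.2 + N%:R * w.2)) (w := w) r0).
- by rewrite mulr_ge0// exprn_ge0// divr_ge0.
- exact: wr.
- by move=> q; exact: UH.
- by apply: IH => // k q kN; apply: UH; exact: leqW.
- by move: h; rewrite /= -natr1 !mulrDl !mul1r !addrA.
Qed.

(** * Second differences of twice differentiable functions *)

Lemma is_derive_line (R : realType) (f : R * R -> R) (p u : R * R) (r : R) :
  derivable f (p + r *: u) u ->
  is_derive r 1 (fun r => f (p + r *: u)) ('D_u f (p + r *: u)).
Proof.
move=> df.
have E : (fun h : R => h^-1 *: (f (p + (h *: (1 : R) + r) *: u) - f (p + r *: u))) =
  (fun h : R => h^-1 *: (f (h *: u + (p + r *: u)) - f (p + r *: u))).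
  apply/funext => h; congr (_ *: (f _ - _)).
  by rewrite [_ *: 1]mulr1 scalerDl addrCA.
split.
  by rewrite /derivable /= E.
by rewrite /derive /= E.
Qed.

Definition second_difference (R : realType) (w : R * R -> R) (u p : R * R) (s : R) : R :=
  w (p + s *: u) + w (p - s *: u) - 2 * w p.

(** By Cauchy's mean value theorem for v (p + r u) + v (p - r u) against r ^ 2,
    the quotient is the mean of the two difference quotients of 'D_u v at p with
    steps c and - c, for some c between 0 and s. *)
Lemma second_difference_cvg (R : realType) (v : R * R -> R) (u p : R * R) :
  (\forall q \near p, derivable v q u) -> derivable ('D_u v) p u ->
  second_difference v u p s / s ^+ 2 @[s --> 0^'+] --> D2 v u u p.
Proof.
move=> dv d2v; apply/cvgrPdist_le => e e0.
have line0 : (fun r : R => p + r *: u) r @[r --> (0:R)] --> p.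
  rewrite -[X in _ --> X](addr0 p) -(scale0r u).
  apply: cvgD; first exact: cvg_cst.
  by apply: cvgZl; exact: cvg_id.
have dline : \forall r \near (0:R), derivable v (p + r *: u) u := line0 _ dv.
have d2' : h^-1 *: ('D_u v (h *: u + p) - 'D_u v p) @[h --> (0:R)^'] --> D2 v u u p.
  exact: d2v.
move/cvgrPdist_le : d2' => /(_ e e0) [d1 /= d10 H1].
move: dline => [d2 /= d20 H2].
near=> s.
have s0 : 0 < s by near: s; exact: nbhs_right_gt.
have sd1 : s < d1 by near: s; exact: nbhs_right_lt.
have sd2 : s < d2 by near: s; exact: nbhs_right_lt.
have dv' r : - s <= r <= s -> derivable v (p + r *: u) u.
  move=> rs; apply: H2; rewrite /= sub0r normrN.
  by apply: le_lt_trans sd2; rewrite ler_norml.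
pose G r := v (p + r *: u) + v (p + (- r) *: u).
pose G' r := 'D_u v (p + r *: u) - 'D_u v (p + (- r) *: u).
have dG r : - s <= r <= s -> is_derive r 1 G (G' r).
  move=> rs; have rs' : - s <= - r <= s by linear.
  have dN : is_derive r 1 (fun x : R => - x) (- 1).
    exact: is_deriveN (is_derive_id r 1).
  have := is_deriveD (is_derive_line (dv' r rs))
    (is_derive1_comp (is_derive_line (dv' (- r) rs')) dN).
  by rewrite mulrN1.
have dS (r : R) : is_derive r 1 (fun r : R => r ^+ 2) (2 * r).
  split; first exact: exprn_derivable.
  by rewrite exp_derive /GRing.scale /= expr1 mulr1.
have [c] : exists2 c, c \in `]0, s[ &
    G' c / (2 * c) = (G s - G 0) / (s ^+ 2 - 0 ^+ 2).
  apply: (@cauchy_MVT R G G' (fun r => r ^+ 2) (fun r => 2 * r) _ _ s0).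
  - apply: derivable_within_continuous => r; rewrite in_itv /= => /andP[h1 h2].
    by apply: (@ex_derive _ _ _ _ _ _ _ (dG r _)); rewrite h2 andbT; linear.
  - apply: derivable_within_continuous => r _.
    exact: (@ex_derive _ _ _ _ _ _ _ (dS r)).
  - by move=> r; rewrite in_itv /= => /andP[h1 h2]; apply: dG; linear.
  - by move=> r _; exact: dS.
  - by move=> r; rewrite in_itv /= => /andP[h1 h2]; rewrite mulf_neq0// gt_eqF.
rewrite in_itv /= => /andP[c0 cs].
rewrite expr0n subr0 /G oppr0 scale0r addr0 => GE.
have -> : second_difference v u p s / s ^+ 2 = G' c / (2 * c).
  rewrite GE /second_difference scaleNr; congr (_ / _); ring.
have k1 : `|D2 v u u p - c^-1 *: ('D_u v (c *: u + p) - 'D_u v p)| <= e.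
  apply: H1 => /=; last by rewrite gt_eqF.
  by rewrite sub0r normrN gtr0_norm//; apply: lt_trans sd1.
have k2 : `|D2 v u u p - (- c)^-1 *: ('D_u v (- c *: u + p) - 'D_u v p)| <= e.
  apply: H1 => /=; last by rewrite oppr_eq0 gt_eqF.
  by rewrite sub0r normrN normrN gtr0_norm//; apply: lt_trans sd1.
have -> : D2 v u u p - G' c / (2 * c) =
  2^-1 * ((D2 v u u p - c^-1 *: ('D_u v (c *: u + p) - 'D_u v p)) +
   (D2 v u u p - (- c)^-1 *: ('D_u v (- c *: u + p) - 'D_u v p))).
  rewrite /G' ![_ + p]addrC /GRing.scale /= invrN.
  field. by rewrite gt_eqF.
have half (a b : R) : `|a| <= e -> `|b| <= e -> `|2^-1 * (a + b)| <= e.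
  by rewrite !ler_norml; linear.
exact: half k1 k2.
Unshelve. all: by end_near. Qed.

Lemma mean_value_horizontal (R : realType) (v : R * R -> R) (x1 x2 y : R) :
  x1 < x2 -> (forall x, x1 <= x <= x2 -> derivable v (x, y) (1, 0)) ->
  exists2 x, x1 < x < x2 &
    v (x2, y) - v (x1, y) = 'D_(1, 0) v (x, y) * (x2 - x1).
Proof.
move=> x12 dv.
have P x : (0, y) + x *: ((1, 0) : R * R) = (x, y).
  congr (_, _); rewrite /= /GRing.scale /=.
    by rewrite mulr1 add0r.
  by rewrite mulr0 addr0.
have dline x : x1 <= x <= x2 ->
   is_derive x 1 (fun x => v (x, y)) ('D_(1, 0) v (x, y)).
  move=> hx; have := @is_derive_line R v (0, y) (1, 0) x.
  have -> : (fun r => v ((0, y) + r *: (1, 0))) = (fun x => v (x, y)).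
    by apply/funext => t; rewrite P.
  by rewrite P => h; apply: h; exact: dv.
have [c] : exists2 c, c \in `]x1, x2[ &
    v (x2, y) - v (x1, y) = 'D_(1, 0) v (c, y) * (x2 - x1).
  apply: (@MVT R (fun x => v (x, y)) (fun x => 'D_(1, 0) v (x, y)) x1 x2 x12).
  - move=> x; rewrite in_itv /= => /andP[h1 h2].
    by apply: dline; rewrite (ltW h1) (ltW h2).
  - apply: derivable_within_continuous => x; rewrite in_itv /= => hx.
    exact: (@ex_derive _ _ _ _ _ _ _ (dline x hx)).
by rewrite in_itv /= => h1 h2; exists c.
Qed.

Lemma C2_derivable (R : realType) (U : set (R * R)) (v : R * R -> R) u p :
  C2_on U v -> U p -> derivable v p u.
Proof. by move=> /(_ u u p) C2 /C2[]. Qed.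

Lemma C2_derivable2 (R : realType) (U : set (R * R)) (v : R * R -> R) u w p :
  C2_on U v -> U p -> derivable ('D_u v) p w.
Proof. by move=> /(_ u w p) C2 /C2[]. Qed.

Lemma C2_second_difference_cvg (R : realType) (U : set (R * R)) (v : R * R -> R)
    (u p : R * R) :
  open U -> C2_on U v -> U p ->
  second_difference v u p s / s ^+ 2 @[s --> 0^'+] --> D2 v u u p.
Proof.
move=> oU C2 Up; apply: second_difference_cvg; last exact: C2_derivable2 C2 Up.
by apply: filterS (open_nbhs_nbhs (conj oU Up)) => q; exact: C2_derivable.
Qed.

Lemma C2_has_laplacian (R : realType) (U : set (R * R)) (v : R * R -> R) p :
  open U -> C2_on U v -> U p -> has_laplacian v p (laplacian v p).
Proof.
move=> oU C2 Up; rewrite /has_laplacian /laplacian.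
have h1 := C2_second_difference_cvg (u := (1, 0)) oU C2 Up.
have h2 := C2_second_difference_cvg (u := (0, 1)) oU C2 Up.
have -> : (fun s => stencil v p s / s ^+ 2) =
    (fun s => second_difference v (1, 0) p s / s ^+ 2 +
      second_difference v (0, 1) p s / s ^+ 2); last exact: cvgD h1 h2.
apply/funext => s; rewrite /stencil /second_difference.
have -> : p + s *: ((1, 0) : R * R) = (p.1 + s, p.2).
  by congr (_, _); rewrite /= /GRing.scale /= ?mulr1 ?mulr0 ?addr0.
have -> : p - s *: ((1, 0) : R * R) = (p.1 - s, p.2).
  by congr (_, _); rewrite /= /GRing.scale /= ?mulr1 ?mulr0 ?subr0.
have -> : p + s *: ((0, 1) : R * R) = (p.1, p.2 + s).
  by congr (_, _); rewrite /= /GRing.scale /= ?mulr1 ?mulr0 ?addr0.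
have -> : p - s *: ((0, 1) : R * R) = (p.1, p.2 - s).
  by congr (_, _); rewrite /= /GRing.scale /= ?mulr1 ?mulr0 ?subr0.
ring.
Qed.

(** * Concavity of the square root of a torsion function *)

Definition mix (R : realType) (l : R) (z1 z2 : R * R) : R * R :=
  ((1 - l) * z1.1 + l * z2.1, (1 - l) * z1.2 + l * z2.2).

Lemma continuous_coordinates (R : realType) :
  [/\ continuous (fun q : (R * R) * (R * R) => q.1.1),
      continuous (fun q : (R * R) * (R * R) => q.1.2),
      continuous (fun q : (R * R) * (R * R) => q.2.1) &
      continuous (fun q : (R * R) * (R * R) => q.2.2)].
Proof.
split=> q.
- by apply: (@continuous_comp _ _ _ fst fst); exact: cvg_fst.
- by apply: (@continuous_comp _ _ _ fst snd); [exact: cvg_fst|exact: cvg_snd].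
- by apply: (@continuous_comp _ _ _ snd fst); [exact: cvg_snd|exact: cvg_fst].
- by apply: (@continuous_comp _ _ _ snd snd); exact: cvg_snd.
Qed.

Lemma continuous_combination (R : realType) (a b : R) :
  continuous (fun q : (R * R) * (R * R) =>
    (a * q.1.1 + b * q.2.1, a * q.1.2 + b * q.2.2)).
Proof.
have [c11 c12 c21 c22] := continuous_coordinates R.
by apply: continuous_fctpair; apply: continuous_fctD; apply: continuous_fctM => //;
  exact: cst_continuous.
Qed.

Lemma mix_swap (R : realType) (l : R) (z1 z2 : R * R) :
  mix l z1 z2 = mix (1 - l) z2 z1.
Proof. by rewrite /mix subKr; congr (_, _); rewrite addrC. Qed.

Definition ray (R : realType) (z : R * R) (s : R) (e : R * R) : R * R :=
  (z.1 + s * e.1, z.2 + s * e.2).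

Lemma stencil_ray (R : realType) (w : R * R -> R) z s :
  stencil w z s = w (ray z s (1, 0)) + w (ray z s (-1, 0))
    + w (ray z s (0, 1)) + w (ray z s (0, -1)) - 4 * w z.
Proof. by rewrite /stencil /ray /= !mulr0 !mulrN !mulr1 !addr0. Qed.

Lemma cvg_scale_dnbhs (R : realType) (t : R) : t != 0 ->
  (s * t) @[s --> 0^'+] --> (0 : R)^'.
Proof.
move=> t0 A /= [e /= e0 eA]; exists (e / `|t|) => /=.
  by rewrite divr_gt0// normr_gt0.
move=> s /=; rewrite sub0r normrN => se s0; apply: eA.
  by rewrite /= sub0r normrN normrM -ltr_pdivlMr// normr_gt0.
by rewrite mulf_neq0// gt_eqF.
Qed.

Lemma cvg_ray (R : realType) (z e : R * R) (t : R) :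
  ray z (s * t) e @[s --> (0 : R)] --> z.
Proof.
have C : continuous (fun s : R => ray z (s * t) e).
  by apply: continuous_fctpair; continuous_polynomial.
have := C 0; rewrite /continuous_at /ray !mul0r !addr0 -surjective_pairing.
exact.
Qed.

Lemma near_ray (R : realType) (O : set (R * R)) (z e : R * R) (t : R) :
  open O -> O z -> \forall s \near (0 : R)^'+, O (ray z (s * t) e).
Proof.
move=> oO Oz.
have : ray z (s * t) e @[s --> (0 : R)^'+] --> z.
  by apply: cvg_at_right_filter; exact: cvg_ray.
by apply; exact: open_nbhs_nbhs.
Qed.

Lemma sqrt_ray_derivative (R : realType) (v : R * R -> R) (z e : R * R) :
  {for z, continuous v} -> derivable v z e -> 0 < v z ->
  exists d : R,
    h^-1 * (Num.sqrt (v (ray z h e)) - Num.sqrt (v z)) @[h --> (0 : R)^'] --> d.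
Proof.
move=> cv dv vz.
pose r := Num.sqrt (v z); have r0 : 0 < r by rewrite sqrtr_gt0.
exists ('D_e v z * (r + r)^-1).
have cray : v (ray z h e) @[h --> (0 : R)^'] --> v z.
  apply: cvg_within_filter; have := @cvg_ray _ z e 1.
  under eq_fun do rewrite mulr1.
  by move=> /cvg_comp; apply; exact: cv.
have dv' : h^-1 * (v (ray z h e) - v z) @[h --> (0 : R)^'] --> 'D_e v z.
  have -> : (fun h : R => h^-1 * (v (ray z h e) - v z)) =
      (fun h : R => h^-1 *: (v (h *: e + z) - v z)).
    by apply/funext => h; rewrite (addrC _ z).
  exact: dv.
have csq : Num.sqrt (v (ray z h e)) @[h --> (0 : R)^'] --> r.
  by apply: (cvg_comp _ _ cray); exact: sqrt_continuous.
have cq : h^-1 * (v (ray z h e) - v z) * (Num.sqrt (v (ray z h e)) + r)^-1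
    @[h --> (0 : R)^'] --> 'D_e v z * (r + r)^-1.
  apply: cvgM; first exact: dv'.
  apply: cvgV; first by rewrite gt_eqF// addr_gt0.
  by apply: cvgD; [exact: csq|exact: cvg_cst].
have E : {near (0 : R)^',
   (fun h => h^-1 * (v (ray z h e) - v z) * (Num.sqrt (v (ray z h e)) + r)^-1)
   =1 (fun h => h^-1 * (Num.sqrt (v (ray z h e)) - Num.sqrt (v z)))}.
  near=> h.
  have vh : 0 < v (ray z h e) by near: h; exact: (cvgr_gt (v z) cray).
  have sh : 0 < Num.sqrt (v (ray z h e)) by rewrite sqrtr_gt0.
  rewrite -mulrA; congr (_ * _).
  rewrite -{1}(sqr_sqrtr (ltW vh)) -{1}(sqr_sqrtr (ltW vz)) -/r.
  by rewrite subr_sqr mulfK// gt_eqF// addr_gt0.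
exact: cvg_trans (near_eq_cvg E) cq.
Unshelve. all: by end_near. Qed.

Lemma within_continuous_comp (S T U : topologicalType) (A : set S) (K : set T)
    (g : S -> T) (f : T -> U) :
  continuous g -> (forall x, A x -> K (g x)) -> {within K, continuous f} ->
  {within A, continuous (fun x => f (g x))}.
Proof.
move=> cg AK /subspace_continuousP cf; apply/subspace_continuousP => x Ax.
apply: (cvg_comp g f _ (cf _ (AK x Ax))).
move=> W; rewrite /within /= => KW.
change (nbhs x (fun y => A y -> W (g y))).
have h0 : nbhs x [set y | K (g y) -> W (g y)] := cg x _ KW.
by apply: filterS h0 => y h Ay; apply: h; exact: AK.
Qed.

(** The function (sqrt a - c) ^ 2 of a is concave because c <= 0; the right-hand
    side is its tangent at a = u ^ 2. *)
Lemma sqrt_tangent_bound (R : realType) (a q u c : R) :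
  0 <= a -> 0 < u -> c <= 0 -> 0 <= q -> q <= Num.sqrt a - c ->
  q ^+ 2 <= a * (1 - c / u) - c * u + c ^+ 2.
Proof.
move=> a0 u0 c0 q0 qa; set t := Num.sqrt a in qa.
have ta : t ^+ 2 = a by rewrite sqr_sqrtr.
have t0 : 0 <= t by exact: sqrtr_ge0.
apply: (@le_trans _ _ ((t - c) ^+ 2)).
  by rewrite ler_pXn2r// nnegrE; linear.
rewrite -subr_ge0 -ta (_ : _ - _ = - c / u * (t - u) ^+ 2); last by field; rewrite gt_eqF.
by rewrite mulr_ge0 ?sqr_ge0// divr_ge0 ?(ltW u0)// oppr_ge0.
Qed.

(** The variation z1 + t l e, z2 - t (1 - l) e leaves [mix l z1 z2] in place, so
    at a minimum of the concavity defect the sum of the two other terms is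
    stationary. *)
Lemma sqrt_gradient_eq (R : realType) (v : R * R -> R) (z1 z2 e : R * R)
    (l d1 d2 : R) :
  0 < l < 1 ->
  h^-1 * (Num.sqrt (v (ray z1 h e)) - Num.sqrt (v z1)) @[h --> (0 : R)^'] --> d1 ->
  h^-1 * (Num.sqrt (v (ray z2 h e)) - Num.sqrt (v z2)) @[h --> (0 : R)^'] --> d2 ->
  (forall t : R, \forall s \near (0 : R)^'+,
    (1 - l) * Num.sqrt (v (ray z1 (s * (t * l)) e)) +
    l * Num.sqrt (v (ray z2 (s * (- t * (1 - l))) e)) <=
    (1 - l) * Num.sqrt (v z1) + l * Num.sqrt (v z2)) ->
  d1 = d2.
Proof.
move=> /andP[l0 l1] h1 h2 H.
have l1' : 0 < 1 - l by rewrite subr_gt0.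
have key (t : R) : t != 0 -> 0 <= (1 - l) * l * (t * (d2 - d1)).
  move=> t0.
  have tl0 : t * l != 0 by rewrite mulf_neq0// gt_eqF.
  have tl1 : - t * (1 - l) != 0 by rewrite mulf_neq0 ?oppr_eq0// gt_eqF.
  have c1 := cvg_comp _ _ (cvg_scale_dnbhs tl0) h1.
  have c2 := cvg_comp _ _ (cvg_scale_dnbhs tl1) h2.
  have c3 := cvgD (cvgM (cvg_cst (t * l * (l - 1))) c1)
    (cvgM (cvg_cst (- t * (1 - l) * (- l))) c2).
  rewrite (_ : _ * (t * _) = t * l * (l - 1) * d1 + - t * (1 - l) * (- l) * d2); last by ring.
  apply: (cvg_at_right_ge0 (c3 _ _ _ _ _)); near=> s.
  have s0 : 0 < s by near: s; exact: nbhs_right_gt.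
  set a := Num.sqrt (v (ray z1 (s * (t * l)) e)).
  set b := Num.sqrt (v (ray z2 (s * (- t * (1 - l))) e)).
  have Hs : (1 - l) * a + l * b <= (1 - l) * Num.sqrt (v z1) + l * Num.sqrt (v z2).
    by rewrite /a /b; near: s; exact: (H t).
  rewrite [X in 0 <= X](_ : _ = s^-1 * ((1 - l) * Num.sqrt (v z1) + l * Num.sqrt (v z2)
     - ((1 - l) * a + l * b))).
    by rewrite mulr_ge0 ?invr_ge0 ?(ltW s0)// subr_ge0.
  rewrite /= -/a -/b; field.
  by rewrite t0 !gt_eqF.
have k1 := key 1 (oner_neq0 _); have k2 := key (-1).
move: k2; rewrite oppr_eq0 oner_eq0 => /(_ isT) k2.
have p0 : 0 < (1 - l) * l by rewrite mulr_gt0.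
move: k1 k2; rewrite !(pmulr_rge0 _ p0) mul1r mulN1r => ? ?.
by apply/eqP; rewrite eq_le; apply/andP; split; linear.
Unshelve. all: by end_near. Qed.

Lemma near_four_directions (R : realType) (P : R * R -> R -> Prop) :
  (forall e : R * R, \forall s \near (0 : R)^'+, P e s) ->
  \forall s \near (0 : R)^'+, [/\ P (1, 0) s, P (-1, 0) s, P (0, 1) s & P (0, -1) s].
Proof. by move=> H; near=> s; split; near: s; exact: H. Unshelve. all: by end_near. Qed.

(** The second-order condition at a minimum of the concavity defect.  When z1 and
    z2 move by s u1 e and s u2 e, the point between them moves by s u e, where
    u = (1 - l) u1 + l u2.  Let w1 and w2 be the values of sqrt v at the moved
    points, and suppose that the defect c = u3 - u is negative.  Minimality and
    [sqrt_tangent_bound] bound the sum of ((1 - l) w1 + l w2) ^ 2 - u ^ 2 over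
    four directions e by (1 - c / u3) times the stencil of v at z3, which is
    about - (1 - c / u3) u ^ 2 s ^ 2.  But the identity

      ((1 - l) w1 + l w2) ^ 2 = u ((1 - l) w1 ^ 2 / u1 + l w2 ^ 2 / u2)
                                - (1 - l) l u1 u2 (w1 / u1 - w2 / u2) ^ 2

    shows that the same sum is about - u ^ 2 s ^ 2, because by the first-order
    condition the last square is o (s ^ 2).  If u2 = 0, then z2 does not move, so
    that z2 may be a boundary point where nothing is known about the derivatives
    of v. *)
Lemma sqrt_concavity_defect_ge0 (R : realType) (v : R * R -> R) (z1 z2 z3 : R * R)
    (l u1 u2 u3 : R) :
  0 < l < 1 -> 0 < u1 -> 0 <= u2 -> 0 < u3 ->
  v z1 = u1 ^+ 2 -> v z2 = u2 ^+ 2 -> v z3 = u3 ^+ 2 ->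
  has_laplacian v z1 (-1) -> has_laplacian v z3 (-1) ->
  (0 < u2 -> has_laplacian v z2 (-1)) ->
  (forall e, 0 < u2 ->
    s^-1 * (Num.sqrt (v (ray z1 (s * u1) e)) / u1 -
            Num.sqrt (v (ray z2 (s * u2) e)) / u2) @[s --> 0^'+] --> 0) ->
  (forall e, \forall s \near (0 : R)^'+,
     [/\ 0 <= v (ray z1 (s * u1) e), 0 <= v (ray z2 (s * u2) e),
       0 <= v (ray z3 (s * ((1 - l) * u1 + l * u2)) e) &
     (1 - l) * Num.sqrt (v (ray z1 (s * u1) e)) +
     l * Num.sqrt (v (ray z2 (s * u2) e)) <=
     Num.sqrt (v (ray z3 (s * ((1 - l) * u1 + l * u2)) e))
       - (u3 - ((1 - l) * u1 + l * u2))]) ->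
  (1 - l) * u1 + l * u2 <= u3.
Proof.
move=> /andP[l0 l1] u10 u20 u30 v1E v2E v3E L1 L3 L2 grad near_min.
have l1' : 0 < 1 - l by rewrite subr_gt0.
rewrite leNgt; apply/negP => ltu.
set u := (1 - l) * u1 + l * u2 in near_min ltu.
have u0 : 0 < u by exact: lt_trans ltu.
pose c := u3 - u; have c0 : c < 0 by rewrite subr_lt0.
pose w1 s e := Num.sqrt (v (ray z1 (s * u1) e)).
pose w2 s e := Num.sqrt (v (ray z2 (s * u2) e)).
pose q s e := (1 - l) * w1 s e + l * w2 s e.
pose S (s : R) := q s (1, 0) ^+ 2 + q s (-1, 0) ^+ 2 + q s (0, 1) ^+ 2 + q s (0, -1) ^+ 2
  - 4 * u ^+ 2.
have upper : \forall s \near (0 : R)^'+, S s <= (1 - c / u3) * stencil v z3 (s * u).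
  near=> s.
  pose V e := v (ray z3 (s * u) e) * (1 - c / u3) - c * u3 + c ^+ 2.
  have [] : [/\ q s (1, 0) ^+ 2 <= V (1, 0), q s (-1, 0) ^+ 2 <= V (-1, 0),
      q s (0, 1) ^+ 2 <= V (0, 1) & q s (0, -1) ^+ 2 <= V (0, -1)].
    rewrite /V; near: s.
    apply: (@near_four_directions _ (fun e s => q s e ^+ 2 <=
      v (ray z3 (s * u) e) * (1 - c / u3) - c * u3 + c ^+ 2)) => e.
    apply: filterS (near_min e) => s [_ _ v30 hq].
    apply: sqrt_tangent_bound => //; first exact: ltW.
    by rewrite addr_ge0// mulr_ge0 ?sqrtr_ge0// ltW.
  rewrite /V stencil_ray v3E /S => p1 p2 p3 p4.
  have E : (1 - c / u3) * (4 * u3 ^+ 2) + 4 * (c ^+ 2 - c * u3) = 4 * u ^+ 2.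
    have -> : u = u3 - c by rewrite /c; ring.
    by field; rewrite gt_eqF.
  linear.
have lower : exists2 T : R -> R, (\forall s \near (0 : R)^'+, T s <= S s / s ^+ 2) &
    T s @[s --> 0^'+] --> - u ^+ 2.
  have [u2E|u2n] := eqVneq u2 0.
    exists (fun s => (1 - l) ^+ 2 * (stencil v z1 (s * u1) / s ^+ 2)).
      near=> s.
      have [p1 p2 p3 p4] : [/\ q s (1, 0) ^+ 2 = (1 - l) ^+ 2 * v (ray z1 (s * u1) (1, 0)),
        q s (-1, 0) ^+ 2 = (1 - l) ^+ 2 * v (ray z1 (s * u1) (-1, 0)),
        q s (0, 1) ^+ 2 = (1 - l) ^+ 2 * v (ray z1 (s * u1) (0, 1)) &
        q s (0, -1) ^+ 2 = (1 - l) ^+ 2 * v (ray z1 (s * u1) (0, -1))].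
        near: s.
        apply: (@near_four_directions _ (fun e s =>
          q s e ^+ 2 = (1 - l) ^+ 2 * v (ray z1 (s * u1) e))) => e.
        apply: filterS (near_min e) => s [v10 _ _ _].
        rewrite /q /w2 u2E mulr0 /ray !mul0r !addr0 -surjective_pairing v2E u2E.
        by rewrite expr0n sqrtr0 mulr0 addr0 exprMn sqr_sqrtr.
      rewrite /S p1 p2 p3 p4 stencil_ray v1E /u u2E.
      by rewrite mulr0 addr0 exprMn mulrA ler_wpM2r ?invr_ge0 ?sqr_ge0//; linear.
    rewrite (_ : - u ^+ 2 = (1 - l) ^+ 2 * (u1 ^+ 2 * -1)).
      by apply: cvgM; [exact: cvg_cst|exact: has_laplacian_scale].
    by rewrite /u u2E; ring.
  have u2p : 0 < u2 by rewrite lt_neqAle eq_sym u2n.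
  pose D e s := (s^-1 * (w1 s e / u1 - w2 s e / u2)) ^+ 2.
  exists (fun s => u * ((1 - l) / u1 * (stencil v z1 (s * u1) / s ^+ 2) +
     l / u2 * (stencil v z2 (s * u2) / s ^+ 2)) -
     (1 - l) * l * u1 * u2 * (D (1, 0) s + D (-1, 0) s + D (0, 1) s + D (0, -1) s)).
    near=> s.
    have s0 : s != 0 by rewrite gt_eqF//; near: s; exact: nbhs_right_gt.
    have [p1 p2 p3 p4] : [/\ w1 s (1, 0) ^+ 2 = v (ray z1 (s * u1) (1, 0)) /\
          w2 s (1, 0) ^+ 2 = v (ray z2 (s * u2) (1, 0)),
        w1 s (-1, 0) ^+ 2 = v (ray z1 (s * u1) (-1, 0)) /\
          w2 s (-1, 0) ^+ 2 = v (ray z2 (s * u2) (-1, 0)),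
        w1 s (0, 1) ^+ 2 = v (ray z1 (s * u1) (0, 1)) /\
          w2 s (0, 1) ^+ 2 = v (ray z2 (s * u2) (0, 1)) &
        w1 s (0, -1) ^+ 2 = v (ray z1 (s * u1) (0, -1)) /\
          w2 s (0, -1) ^+ 2 = v (ray z2 (s * u2) (0, -1))].
      near: s.
      apply: (@near_four_directions _ (fun e s => w1 s e ^+ 2 = v (ray z1 (s * u1) e) /\
        w2 s e ^+ 2 = v (ray z2 (s * u2) e))) => e.
      by apply: filterS (near_min e) => s [? ? _ _]; split; exact: sqr_sqrtr.
    rewrite !stencil_ray v1E v2E.
    have [<- <-] := p1; have [<- <-] := p2; have [<- <-] := p3; have [<- <-] := p4.
    rewrite le_eqVlt; apply/orP; left; apply/eqP; rewrite /S /q /D.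
    move: (w1 s (1, 0)) (w1 s (-1, 0)) (w1 s (0, 1)) (w1 s (0, -1))
      (w2 s (1, 0)) (w2 s (-1, 0)) (w2 s (0, 1)) (w2 s (0, -1)) => a1 a2 a3 a4 b1 b2 b3 b4.
    by rewrite /u; field; rewrite s0 !gt_eqF.
  have cD e : D e s @[s --> 0^'+] --> (0 : R).
    have -> : D e = (fun s => (s^-1 * (w1 s e / u1 - w2 s e / u2)) *
        (s^-1 * (w1 s e / u1 - w2 s e / u2))).
      by apply/funext => s; rewrite /D expr2.
    by rewrite -[X in _ --> X](mulr0 (0 : R)); apply: cvgM; exact: grad.
  rewrite (_ : - u ^+ 2 = u * ((1 - l) / u1 * (u1 ^+ 2 * -1) + l / u2 * (u2 ^+ 2 * -1)) -
     (1 - l) * l * u1 * u2 * (0 + 0 + 0 + 0)); last first.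
    by rewrite /u; field; rewrite !gt_eqF.
  apply: cvgB; last by apply: cvgM; [exact: cvg_cst|do 3! (apply: cvgD => //)].
  apply: cvgM; first exact: cvg_cst.
  apply: cvgD; (apply: cvgM; first exact: cvg_cst); apply: has_laplacian_scale => //.
  exact: L2.
have [T TS Tlim] := lower.
have lim3 := cvgB (cvgM (cvg_cst (1 - c / u3)) (has_laplacian_scale u0 L3)) Tlim.
have : 0 <= (1 - c / u3) * (u ^+ 2 * -1) - - u ^+ 2.
  apply: (cvg_at_right_ge0 (lim3 _ _ _)); near=> s.
  have s0 : 0 < s by near: s; exact: nbhs_right_gt.
  have h1 : T s <= S s / s ^+ 2 by near: s.
  have h2 : S s <= (1 - c / u3) * stencil v z3 (s * u) by near: s.
  rewrite /= subr_ge0; apply: le_trans h1 _.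
  by rewrite mulrA ler_wpM2r// invr_ge0 sqr_ge0.
apply/negP; rewrite -ltNge.
rewrite (_ : _ - _ = c * (u ^+ 2 / u3)); last by field; rewrite gt_eqF.
by rewrite nmulr_rlt0// divr_gt0// exprn_gt0.
Unshelve. all: by end_near. Qed.

(** The theorem of Makar-Limanov, by Kennington's method: the concavity defect has
    a minimum over pairs of points of K.  It is nonnegative at pairs of boundary
    points, where v = 0; otherwise the point between z1 and z2 is interior and
    [sqrt_concavity_defect_ge0] applies, with an interior point in the role of
    its z1. *)
Lemma sqrt_torsion_concave_interior (R : realType) (K O : set (R * R))
    (v : R * R -> R) (l : R) :
  compact K -> open O -> O `<=` K -> 0 < l < 1 ->
  {within K, continuous v} ->
  (forall p, K p -> 0 <= v p) -> (forall p, K p -> ~ O p -> v p = 0) ->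
  (forall p, O p -> [/\ 0 < v p, has_laplacian v p (-1) & forall e, derivable v p e]) ->
  (forall z1 z2, K z1 -> K z2 -> K (mix l z1 z2)) ->
  (forall z1 z2, K z1 -> K z2 -> O z1 \/ O z2 -> O (mix l z1 z2)) ->
  forall z1 z2, K z1 -> K z2 ->
    (1 - l) * Num.sqrt (v z1) + l * Num.sqrt (v z2) <=
    Num.sqrt (v (mix l z1 z2)).
Proof.
move=> cK oO OK l01 cv v0 vb vO Kconv Oconv.
have /andP[l0 l1] := l01; have l1' : 0 < 1 - l by rewrite subr_gt0.
pose F (z : (R * R) * (R * R)) := Num.sqrt (v (mix l z.1 z.2)) +
  (- (1 - l) * Num.sqrt (v z.1) + - l * Num.sqrt (v z.2)).
suff H : forall z, (K `*` K) z -> 0 <= F z.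
  by move=> z1 z2 K1 K2; have := H (z1, z2) (conj K1 K2); rewrite /F /mix /=; linear.
have csqrt : continuous (@Num.sqrt R) by exact: sqrt_continuous.
have cw (g : (R * R) * (R * R) -> R * R) : continuous g ->
    (forall z, (K `*` K) z -> K (g z)) ->
    {within K `*` K, continuous (fun z => Num.sqrt (v (g z)))}.
  move=> cg gK; have cvg := within_continuous_comp cg gK cv.
  apply/subspace_continuousP => z Kz.
  have /subspace_continuousP/(_ z Kz) h := cvg.
  exact: (cvg_comp _ _ h (csqrt _)).
have cF : {within K `*` K, continuous F}.
  apply: within_continuousD.
    apply: cw; last by move=> z [h1 h2]; exact: Kconv.
    exact: continuous_combination.
  apply: within_continuousD; (apply: within_continuousM; first by move=> ?; exact: cvg_cst).
    by apply: cw; [exact: continuous_fst|move=> z []].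
  by apply: cw; [exact: continuous_snd|move=> z []].
move=> z Kz.
have [[z1 z2] [/= K1 K2] Fmin] :=
  compact_minimum (ex_intro _ z Kz) (compact_setX cK cK) cF.
have {Kz} zmin := Fmin z Kz; apply: le_trans zmin.
have {}Fmin y1 y2 : K y1 -> K y2 -> F (z1, z2) <= F (y1, y2).
  by move=> Ky1 Ky2; exact: Fmin.
have [h12|nO12] := pselect (O z1 \/ O z2); last first.
  rewrite /F /= (vb z1) ?(vb z2)//; last 2 first.
  - by move=> h; apply: nO12; right.
  - by move=> h; apply: nO12; left.
  by rewrite sqrtr0 !mulr0 !addr0 sqrtr_ge0.
have O3 : O (mix l z1 z2) by exact: Oconv.
pose u1 := Num.sqrt (v z1); pose u2 := Num.sqrt (v z2); pose u3 := Num.sqrt (v (mix l z1 z2)).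
have vE p : K p -> v p = Num.sqrt (v p) ^+ 2 by move=> Kp; rewrite sqr_sqrtr// v0.
have u30 : 0 < u3 by rewrite sqrtr_gt0; have [] := vO _ O3.
have u10 : 0 <= u1 by exact: sqrtr_ge0.
have u20 : 0 <= u2 by exact: sqrtr_ge0.
have uO p : K p -> 0 < Num.sqrt (v p) -> O p.
  move=> Kp; have [//|nOp] := pselect (O p).
  by rewrite (vb p Kp nOp) sqrtr0 ltxx.
suff : (1 - l) * u1 + l * u2 <= u3 by rewrite /F /= -/u1 -/u2 -/u3; linear.
have stay p (e : R * R) : K p ->
    \forall s \near (0 : R)^'+, K (ray p (s * Num.sqrt (v p)) e).
  move=> Kp; have [hp|nOp] := pselect (O p).
    by apply: filterS (near_ray e (Num.sqrt (v p)) oO hp) => s; exact: OK.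
  near=> s; rewrite (vb p Kp nOp) sqrtr0 mulr0 /ray !mul0r !addr0.
  by rewrite -surjective_pairing.
have cO p : O p -> {for p, continuous v}.
  move=> Op; have Kp := OK _ Op.
  have /subspace_continuousP/(_ p Kp) := cv.
  rewrite within_interior//.
  by apply: filterS OK _; exact: open_nbhs_nbhs.
have near_min e : \forall s \near (0 : R)^'+,
     [/\ 0 <= v (ray z1 (s * u1) e), 0 <= v (ray z2 (s * u2) e),
       0 <= v (ray (mix l z1 z2) (s * ((1 - l) * u1 + l * u2)) e) &
     (1 - l) * Num.sqrt (v (ray z1 (s * u1) e)) +
     l * Num.sqrt (v (ray z2 (s * u2) e)) <=
     Num.sqrt (v (ray (mix l z1 z2) (s * ((1 - l) * u1 + l * u2)) e))
       - (u3 - ((1 - l) * u1 + l * u2))].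
  near=> s.
  have k1 : K (ray z1 (s * u1) e) by near: s; exact: stay.
  have k2 : K (ray z2 (s * u2) e) by near: s; exact: stay.
  have mE : mix l (ray z1 (s * u1) e) (ray z2 (s * u2) e) =
      ray (mix l z1 z2) (s * ((1 - l) * u1 + l * u2)) e.
    by rewrite /mix /ray /=; congr (_, _); ring.
  have k3 : K (ray (mix l z1 z2) (s * ((1 - l) * u1 + l * u2)) e).
    by rewrite -mE; exact: Kconv.
  split; [exact: v0|exact: v0|exact: v0|].
  have := Fmin _ _ k1 k2; rewrite /F /= mE -/u1 -/u2 -/u3; linear.
have grad e : 0 < u1 -> 0 < u2 ->
    s^-1 * (Num.sqrt (v (ray z1 (s * u1) e)) / u1 -
            Num.sqrt (v (ray z2 (s * u2) e)) / u2) @[s --> 0^'+] --> (0 : R).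
  move=> u1p u2p.
  have O1 := uO _ K1 u1p; have O2 := uO _ K2 u2p.
  have [v1p _ dv1] := vO _ O1; have [v2p _ dv2] := vO _ O2.
  have [d1 D1] := sqrt_ray_derivative (cO _ O1) (dv1 e) v1p.
  have [d2 D2] := sqrt_ray_derivative (cO _ O2) (dv2 e) v2p.
  have d12 : d1 = d2.
    apply: (sqrt_gradient_eq l01 D1 D2) => t; near=> s.
    have k1 : K (ray z1 (s * (t * l)) e).
      by apply: OK; near: s; exact: near_ray.
    have k2 : K (ray z2 (s * (- t * (1 - l))) e).
      by apply: OK; near: s; exact: near_ray.
    have := Fmin _ _ k1 k2.
    have mE : mix l (ray z1 (s * (t * l)) e) (ray z2 (s * (- t * (1 - l))) e) = mix l z1 z2.
      by rewrite /mix /ray /=; congr (_, _); ring.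
    by rewrite /F /= mE; linear.
  have c1 := cvg_comp _ _ (cvg_scale_dnbhs (lt0r_neq0 u1p)) D1.
  have c2 := cvg_comp _ _ (cvg_scale_dnbhs (lt0r_neq0 u2p)) D2.
  have c3 := cvgB c1 c2; rewrite d12 subrr in c3.
  have E : {near (0 : R)^'+, (fun s => (s * u1)^-1 * (Num.sqrt (v (ray z1 (s * u1) e)) - u1) -
    (s * u2)^-1 * (Num.sqrt (v (ray z2 (s * u2) e)) - u2)) =1
    (fun s => s^-1 * (Num.sqrt (v (ray z1 (s * u1) e)) / u1 -
            Num.sqrt (v (ray z2 (s * u2) e)) / u2))}.
    near=> s; have s0 : s != 0 by rewrite gt_eqF//; near: s; exact: nbhs_right_gt.
    by field; rewrite s0 !gt_eqF.
  exact: cvg_trans (near_eq_cvg E) (c3 _).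
have [u1p|u1n] := ltP 0 u1.
  apply: (sqrt_concavity_defect_ge0 l01 u1p u20 u30 _ _ _ _ _ _ _ near_min);
    [exact: vE|exact: vE|apply: vE; exact: OK| | | |].
  - by have [] := vO _ (uO _ K1 u1p).
  - by have [] := vO _ O3.
  - by move=> u2p; have [] := vO _ (uO _ K2 u2p).
  - by move=> e u2p; exact: grad.
have u1E : u1 = 0 by apply/eqP; rewrite eq_le u1n u10.
have u2p : 0 < u2.
  case: h12 => [h1|h2]; last by rewrite sqrtr_gt0; have [] := vO _ h2.
  by move: u1n; rewrite leNgt sqrtr_gt0; have [-> ] := vO _ h1.
have l01' : 0 < 1 - l < 1 by rewrite l1' /=; linear.
suff : (1 - (1 - l)) * u2 + (1 - l) * u1 <= u3 by linear.
apply: (sqrt_concavity_defect_ge0 (z1 := z2) (z2 := z1) (z3 := mix l z1 z2) (v := v)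
   l01' u2p u10 u30);
    [exact: vE|exact: vE|apply: vE; exact: OK| | | | |].
- by have [] := vO _ (uO _ K2 u2p).
- by have [] := vO _ O3.
- by rewrite u1E ltxx.
- by rewrite u1E ltxx.
- move=> e; apply: filterS (near_min e) => s [h1 h2 h3 h4].
  have -> : (1 - (1 - l)) * u2 + (1 - l) * u1 = (1 - l) * u1 + l * u2 by ring.
  by split => //; linear.
Unshelve. all: by end_near. Qed.

(** * Horizontal differences of a torsion function on a rectangle *)

Definition dx (R : realType) (w : R * R -> R) (s : R) (p : R * R) : R :=
  w (p.1 + s, p.2) - w p.

Definition ddx (R : realType) (w : R * R -> R) (s : R) (p : R * R) : R :=
  w (p.1 + s, p.2) + w (p.1 - s, p.2) - 2 * w p.

(** The parameter k counts in units of t how far a point is from the sides of the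
    rectangle [A, B] x [1/5, 4/5]; each estimate below consumes a few units. *)
Definition inset (R : realType) (A B t k : R) (p : R * R) : Prop :=
  (A + k * t <= p.1 <= B - k * t) /\ (1 / 5 + k * t <= p.2 <= 4 / 5 - k * t).

Lemma inset_shift (R : realType) (A B t k k' a b : R) (p : R * R) :
  0 <= t -> inset A B t k p -> `|a| <= k' * t -> `|b| <= k' * t ->
  inset A B t (k - k') (p.1 + a, p.2 + b).
Proof.
move=> t0 [/andP[h1 h2] /andP[h3 h4]]; rewrite !ler_norml => /andP[h5 h6] /andP[h7 h8].
by split => /=; rewrite mulrBl; apply/andP; split; linear.
Qed.

Lemma inset_le (R : realType) (A B t k k' : R) (p : R * R) :
  0 <= t -> k' <= k -> inset A B t k p -> inset A B t k' p.
Proof.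
move=> t0 kk [/andP[h1 h2] /andP[h3 h4]].
have : k' * t <= k * t by rewrite ler_wpM2r.
by move=> h; split; apply/andP; split; linear.
Qed.

Lemma inset_near (R : realType) (A B t k k' : R) (p q : R * R) :
  0 <= t -> inset A B t k p -> `|q.1 - p.1| <= k' * t -> `|q.2 - p.2| <= k' * t ->
  inset A B t (k - k') q.
Proof.
move=> t0 hp h1 h2; have := inset_shift t0 hp h1 h2.
by rewrite !subrKC -surjective_pairing.
Qed.

Lemma harmonic_at_cst (R : realType) (c : R) (p : R * R) : harmonic_at (fun=> c) p.
Proof.
split; first exact: cst_continuous.
by apply: (@has_laplacian_poly _ _ _ _ 0) => s; rewrite /stencil; ring.
Qed.

Lemma harmonic_dx (R : realType) (v : R * R -> R) (s : R) (p : R * R) :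
  {for p, continuous v} -> {for (p.1 + s, p.2), continuous v} ->
  has_laplacian v p (-1) -> has_laplacian v (p.1 + s, p.2) (-1) ->
  harmonic_at (dx v s) p.
Proof.
move=> c1 c2 l1 l2.
have sE : (fun q : R * R => v (q.1 + s, q.2)) = (fun q => v (q.1 + s, q.2 + 0)).
  by apply/funext => q; rewrite addr0.
split.
  apply: cvgB; last exact: c1.
  apply: (@continuous_comp _ _ _ (fun q : R * R => (q.1 + s, q.2)) v) => //.
  by apply: continuous_fctpair; continuous_polynomial.
have l2' : has_laplacian (fun q => v (q.1 + s, q.2)) p (-1).
  by rewrite sE; apply: has_laplacian_shift; rewrite addr0.
have := has_laplacian_lin 1 (-1) l2' l1.
have -> : (fun q : R * R => 1 * v (q.1 + s, q.2) + -1 * v q) = dx v s.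
  by apply/funext => q; rewrite mul1r mulN1r.
by rewrite mul1r mulN1r subrr.
Qed.

(** The interior gradient estimate: [harmonic_difference_bound] for the box of
    half side t about the midpoint of the two points. *)
Lemma harmonic_lipschitz (R : realType) (q : R * R -> R) (A B t k N r : R) (p : R * R) :
  0 < t -> (forall p, inset A B t k p -> harmonic_at q p /\ `|q p| <= N) ->
  `|r| <= t -> inset A B t (k + 2) p ->
  `|q (p.1 + r, p.2) - q p| <= 2 * N / t * `|r| /\
  `|q (p.1, p.2 + r) - q p| <= 2 * N / t * `|r|.
Proof.
move=> t0 H rt hp.
have r2 : `|r / 2| <= 1 / 2 * t by rewrite normrM (ger0_norm (_ : 0 <= 2^-1)); linear.
have r2' : `|r / 2| <= t by linear.
have E : 2 * N / t * `|r| = 4 * N / t * `|r / 2|.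
  by rewrite normrM (ger0_norm (_ : 0 <= 2^-1)); [field; rewrite gt_eqF|linear].
have zt : `|0 : R| <= 1 / 2 * t by rewrite normr0; linear.
have sub c : inset A B t (k + 2 - 1 / 2) c -> forall p', box c t p' ->
    harmonic_at q p' /\ `|q p'| <= N.
  move=> hc p' [b1 b2]; apply: H.
  apply: (@inset_le _ _ _ _ (k + 2 - 1 / 2 - 1)) => //; [exact: ltW|linear|].
  by apply: inset_near hc _ _; rewrite ?mul1r// ltW.
rewrite E; split.
  have hc := inset_shift (ltW t0) hp r2 zt; rewrite addr0 in hc.
  have := harmonic_difference_bound t0 (sub _ hc) r2' => /=.
  by rewrite addrK -addrA -splitr -surjective_pairing.
have hc := inset_shift (ltW t0) hp zt r2; rewrite addr0 in hc.
have := harmonic_difference_bound_vertical t0 (sub _ hc) r2' => /=.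
by rewrite addrK -addrA -splitr -surjective_pairing.
Qed.

Lemma dx_bound (R : realType) (v : R * R -> R) (p : R * R) (s D : R) :
  (forall x, Num.min p.1 (p.1 + s) <= x <= Num.max p.1 (p.1 + s) ->
    derivable v (x, p.2) (1, 0) /\ `|'D_(1, 0) v (x, p.2)| <= D) ->
  `|dx v s p| <= D * `|s|.
Proof.
move=> H; rewrite /dx [in v p](surjective_pairing p).
have [s0|s0|->] := ltrgtP s 0; last by rewrite addr0 subrr !normr0 mulr0.
  have ps : p.1 + s < p.1 by linear.
  have [|x hx E] := @mean_value_horizontal _ v (p.1 + s) p.1 p.2 ps.
    move=> x hx; have [] := H x; last by [].
    by rewrite minC maxC /Num.min /Num.max !ps.
  rewrite distrC E normrM.
  have -> : `|p.1 - (p.1 + s)| = `|s| by rewrite opprD addNKr normrN.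
  rewrite ler_wpM2r//; have [] := H x; last by [].
  rewrite minC maxC /Num.min /Num.max !ps.
  by move: hx => /andP[/ltW-> /ltW->].
have ps : p.1 < p.1 + s by linear.
have [|x hx E] := @mean_value_horizontal _ v p.1 (p.1 + s) p.2 ps.
  move=> x hx; have [] := H x; last by [].
  by rewrite /Num.min /Num.max !ps.
rewrite E normrM.
have -> : `|p.1 + s - p.1| = `|s| by rewrite addrAC subrr add0r.
rewrite ler_wpM2r//; have [] := H x; last by [].
rewrite /Num.min /Num.max !ps.
by move: hx => /andP[/ltW-> /ltW->].
Qed.

(** D bounds the horizontal derivative of v; the bound is put on differences,
    which is the form in which it is used. *)
Definition flat_torsion (R : realType) (A B t D : R) (v : R * R -> R) : Prop :=
  (forall p, inset A B t 0 p -> {for p, continuous v} /\ has_laplacian v p (-1)) /\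
  (forall s p, `|s| <= t -> inset A B t 1 p -> `|dx v s p| <= D * `|s|).

Lemma flat_torsion_harmonic_dx (R : realType) (A B t D s : R) (v : R * R -> R) p :
  0 < t -> flat_torsion A B t D v -> `|s| <= t -> inset A B t 1 p ->
  harmonic_at (dx v s) p.
Proof.
move=> t0 [H _] st hp.
have [c1 l1] := H _ (inset_le (ltW t0) ler01 hp).
have ps : inset A B t 0 (p.1 + s, p.2).
  rewrite -[p.2]addr0 -[X in inset A B t X](subrr 1).
  by apply: inset_shift; rewrite ?mul1r ?normr0 ?(ltW t0).
have [c2 l2] := H _ ps.
exact: harmonic_dx.
Qed.

Lemma dx_lipschitz (R : realType) (A B t D s r : R) (v : R * R -> R) p :
  0 < t -> flat_torsion A B t D v -> `|s| <= t -> `|r| <= t -> inset A B t 3 p ->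
  `|dx v s (p.1 + r, p.2) - dx v s p| <= 2 * D / t * `|s| * `|r| /\
  `|dx v s (p.1, p.2 + r) - dx v s p| <= 2 * D / t * `|s| * `|r|.
Proof.
move=> t0 F st rt hp.
have E : 2 * D / t * `|s| * `|r| = 2 * (D * `|s|) / t * `|r|.
  by field; rewrite gt_eqF.
rewrite E; apply: (@harmonic_lipschitz _ _ A B t 1) => //.
  move=> q hq; split; first exact: flat_torsion_harmonic_dx F st hq.
  by have [_ h] := F; exact: h.
Qed.

Lemma ddxE (R : realType) (v : R * R -> R) s p :
  ddx v s p = dx v s p - dx v s (p.1 - s, p.2).
Proof. by rewrite /ddx /dx /= subrK -surjective_pairing; ring. Qed.

Lemma ddx_bound (R : realType) (A B t D s : R) (v : R * R -> R) p :
  0 < t -> flat_torsion A B t D v -> `|s| <= t -> inset A B t 4 p ->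
  `|ddx v s p| <= 2 * D / t * s ^+ 2.
Proof.
move=> t0 F st hp; rewrite ddxE.
have hq : inset A B t 3 (p.1 - s, p.2).
  rewrite -[p.2]addr0 (_ : 3 = 4 - 1); last by ring.
  by apply: inset_shift; rewrite ?mul1r ?normr0 ?normrN ?(ltW t0).
have [h _] := dx_lipschitz t0 F st st hq.
move: h => /=; rewrite subrK -surjective_pairing.
by rewrite -mulrA -expr2 real_normK// num_real.
Qed.

Lemma ddx_harmonic (R : realType) (A B t D s : R) (v : R * R -> R) p :
  0 < t -> flat_torsion A B t D v -> `|s| <= t -> inset A B t 2 p ->
  harmonic_at (ddx v s) p.
Proof.
move=> t0 F st hp.
have hp1 : inset A B t 1 p by apply: inset_le hp; rewrite ?(ltW t0)//; linear.
have hq : inset A B t 1 (p.1 - s, p.2).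
  rewrite -[p.2]addr0 (_ : 1 = 2 - 1); last by ring.
  by apply: inset_shift; rewrite ?mul1r ?normr0 ?normrN ?(ltW t0).
have h1 := flat_torsion_harmonic_dx t0 F st hp1.
have h2 := flat_torsion_harmonic_dx t0 F st hq.
have h2' : harmonic_at (fun q : R * R => dx v s (q.1 + - s, q.2 + 0)) p.
  by apply: harmonic_at_shift; rewrite addr0.
have := harmonic_at_lin 1 (-1) h1 h2'.
by congr harmonic_at; apply/funext => q; rewrite ddxE mul1r mulN1r addr0.
Qed.

Lemma ddx_lipschitz (R : realType) (A B t D s r : R) (v : R * R -> R) p :
  0 < t -> flat_torsion A B t D v -> `|s| <= t -> `|r| <= t -> inset A B t 6 p ->
  `|ddx v s (p.1 + r, p.2) - ddx v s p| <= 4 * D / t ^+ 2 * s ^+ 2 * `|r| /\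
  `|ddx v s (p.1, p.2 + r) - ddx v s p| <= 4 * D / t ^+ 2 * s ^+ 2 * `|r|.
Proof.
move=> t0 F st rt hp.
have E : 4 * D / t ^+ 2 * s ^+ 2 * `|r| = 2 * (2 * D / t * s ^+ 2) / t * `|r|.
  by field; rewrite gt_eqF.
rewrite E; apply: (@harmonic_lipschitz _ _ A B t 4) => //.
  move=> q hq; split; last exact: ddx_bound F st hq.
  apply: (ddx_harmonic t0 F st); apply: inset_le hq; rewrite ?(ltW t0)//; linear.
by rewrite (_ : 4 + 2 = 6)//; ring.
Qed.

(** The function e - ddx v s is harmonic and nonnegative.  It is at least
    2 m s ^ 2 at p0, hence at least m s ^ 2 on the disc of radius rho by
    [ddx_lipschitz], and N steps of [positivity_chain] along the segment from p0
    to p reduce this by the factor (3 / 10) ^ N. *)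
Lemma ddx_negativity_spread (R : realType) (A B t D s m e rho : R) (N : nat)
    (v : R * R -> R) (p0 p : R * R) :
  0 < t -> 0 <= D -> flat_torsion A B t D v -> `|s| <= t ->
  0 < rho <= t -> 8 * D / t ^+ 2 * rho <= m ->
  (forall q, inset A B t 1 q -> ddx v s q <= e) -> 0 <= e ->
  inset A B t 8 p0 -> inset A B t 8 p ->
  ddx v s p0 <= - (2 * m * s ^+ 2) ->
  (0 < N)%N -> 5 * (`|p.1 - p0.1| + `|p.2 - p0.2|) <= N%:R * rho ->
  ddx v s p <= e - (3 / 10) ^+ N * (m * s ^+ 2).
Proof.
move=> t0 D0 F st /andP[r0 rt] rm he e0 hp0 hp neg N0 pN.
have m0 : 0 <= m.
  by apply: le_trans rm; rewrite mulr_ge0 ?(ltW r0)// divr_ge0 ?sqr_ge0 ?mulr_ge0.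
pose U q := 1 * e + (-1) * ddx v s q.
pose w := ((p.1 - p0.1) / N%:R, (p.2 - p0.2) / N%:R).
have Np : 0 < N%:R :> R by rewrite ltr0n.
have abs2 (a b c : R) : 0 <= c -> a ^+ 2 + b ^+ 2 <= c ^+ 2 -> `|a| <= c /\ `|b| <= c.
  move=> c0 h; split; apply: sqr_le_abs => //.
    by have := sqr_ge0 b; linear.
  by have := sqr_ge0 a; linear.
have seg k : (k <= N)%N -> inset A B t 8 (p0.1 + k%:R * w.1, p0.2 + k%:R * w.2).
  move=> kN; pose l : R := k%:R / N%:R.
  have l0 : 0 <= l by rewrite divr_ge0// ler0n.
  have l1 : l <= 1 by rewrite ler_pdivrMr// mul1r ler_nat.
  have -> : k%:R * w.1 = l * (p.1 - p0.1) by rewrite /w /l /=; ring.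
  have -> : k%:R * w.2 = l * (p.2 - p0.2) by rewrite /w /l /=; ring.
  move: hp0 hp => [/andP[a1 a2] /andP[a3 a4]] [/andP[b1 b2] /andP[b3 b4]].
  have conv x y z : x <= y -> x <= z -> x <= y + l * (z - y).
    move=> h1 h2; have -> : y + l * (z - y) = (1 - l) * y + l * z by ring.
    have : (1 - l) * x <= (1 - l) * y by rewrite ler_wpM2l// subr_ge0.
    have : l * x <= l * z by rewrite ler_wpM2l.
    linear.
  have conv' x y z : y <= x -> z <= x -> y + l * (z - y) <= x.
    move=> h1 h2; have -> : y + l * (z - y) = (1 - l) * y + l * z by ring.
    have : (1 - l) * y <= (1 - l) * x by rewrite ler_wpM2l// subr_ge0.
    have : l * z <= l * x by rewrite ler_wpM2l.
    linear.
  by split => /=; rewrite ?conv ?conv'.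
have wr : w.1 ^+ 2 + w.2 ^+ 2 <= (rho / 5) ^+ 2.
  set a := `|p.1 - p0.1| in pN; set b := `|p.2 - p0.2| in pN.
  have a0 : 0 <= a by exact: normr_ge0.
  have b0 : 0 <= b by exact: normr_ge0.
  have aE : (p.1 - p0.1) ^+ 2 = a ^+ 2 by rewrite real_normK// num_real.
  have bE : (p.2 - p0.2) ^+ 2 = b ^+ 2 by rewrite real_normK// num_real.
  have -> : w.1 ^+ 2 + w.2 ^+ 2 = (a ^+ 2 + b ^+ 2) / N%:R ^+ 2.
    by rewrite -aE -bE /w /=; field; rewrite gt_eqF.
  have -> : (rho / 5) ^+ 2 = (N%:R * rho / 5) ^+ 2 / N%:R ^+ 2.
    by field; rewrite gt_eqF.
  rewrite ler_wpM2r ?invr_ge0 ?sqr_ge0//.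
  apply: (@le_trans _ _ ((a + b) ^+ 2)).
    by have := mulr_ge0 a0 b0; linear.
  by rewrite ler_pXn2r ?nnegrE//; linear.
have start q : dist2 p0 q <= rho ^+ 2 -> m * s ^+ 2 <= U q.
  rewrite /dist2 => /(abs2 _ _ _ (ltW r0)) [h1 h2].
  have h1t : `|q.1 - p0.1| <= t by linear.
  have h2t : `|q.2 - p0.2| <= t by linear.
  have hp6 : inset A B t 6 p0 by apply: inset_le hp0; rewrite ?(ltW t0)//; linear.
  have [L1 _] := ddx_lipschitz t0 F st h1t hp6.
  have hp7 : inset A B t 6 (q.1, p0.2).
    apply: (@inset_le _ _ _ _ (8 - 1)); [exact: ltW|linear|].
    by apply: inset_near hp0 _ _; rewrite ?mul1r//= ?subrr ?normr0 ?(ltW t0).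
  have [_ L2] := ddx_lipschitz t0 F st h2t hp7.
  move: L1 L2; rewrite /= !subrKC -surjective_pairing.
  set X := ddx v s (q.1, p0.2).
  have C0 : 0 <= 4 * D / t ^+ 2 * s ^+ 2.
    by rewrite mulr_ge0 ?sqr_ge0// divr_ge0 ?sqr_ge0// mulr_ge0.
  have b1 := ler_wpM2l C0 h1; have b2 := ler_wpM2l C0 h2.
  have b3 : 2 * (4 * D / t ^+ 2 * s ^+ 2 * rho) <= m * s ^+ 2.
    have := ler_wpM2r (sqr_ge0 s) rm; linear.
  move=> /ler_normlP[_ L1] /ler_normlP[_ L2].
  rewrite /U; linear.
have Uh k q : (k < N)%N ->
    dist2 (p0.1 + k%:R * w.1, p0.2 + k%:R * w.2) q <= 2 * rho ^+ 2 ->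
    harmonic_at U q /\ 0 <= U q.
  move=> kN hq; have hc := seg k (ltnW kN).
  have [h1 h2] : `|q.1 - (p0.1 + k%:R * w.1)| <= 2 * t /\ `|q.2 - (p0.2 + k%:R * w.2)| <= 2 * t.
    apply: abs2; first linear.
    apply: (le_trans hq); rewrite exprMn.
    have : rho ^+ 2 <= t ^+ 2 by rewrite ler_pXn2r ?nnegrE//; linear.
    by have := sqr_ge0 t; linear.
  have q6 := inset_near (ltW t0) hc h1 h2.
  split.
    apply: harmonic_at_lin; first exact: harmonic_at_cst.
    by apply: (ddx_harmonic t0 F st); apply: inset_le q6; rewrite ?(ltW t0)//; linear.
  have := he q (inset_le (ltW t0) _ q6); rewrite /U => h.
  have := h _; linear.
have ms0 : 0 <= m * s ^+ 2 by rewrite mulr_ge0// sqr_ge0.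
have := positivity_chain r0 ms0 wr Uh start (p := p).
rewrite /w /= !mulrA ![N%:R * _]mulrC !mulfK ?gt_eqF// !subrKC /dist2 /= !subrr.
rewrite expr0n addr0 => /(_ (sqr_ge0 _)); rewrite /U; linear.
Qed.

(** * Bounds on the Hessian *)

Lemma cvg_at_right_norm_le (R : realType) (f : R -> R) (l C : R) :
  f s @[s --> 0^'+] --> l -> (\forall s \near 0^'+, `|f s| <= C) -> `|l| <= C.
Proof.
move=> fl fC; have h := cvg_norm fl.
have h2 := cvgB (cvg_cst C) (h _).
rewrite -subr_ge0; apply: (cvg_at_right_ge0 (h2 _ _ _)).
by apply: filterS fC => s; rewrite subr_ge0.
Qed.

Lemma second_differenceE (R : realType) (v : R * R -> R) (a b : R) p s :
  second_difference v (a, b) p s =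
  v (p.1 + s * a, p.2 + s * b) + v (p.1 - s * a, p.2 - s * b) - 2 * v p.
Proof. by []. Qed.

Lemma second_difference_scale_cvg (R : realType) (v : R * R -> R) (u p : R * R)
    (a l : R) :
  second_difference v u p s / s ^+ 2 @[s --> 0^'+] --> l ->
  second_difference v u p (s * a) / s ^+ 2 @[s --> 0^'+] --> a ^+ 2 * l.
Proof.
move=> h; have [->|a0] := eqVneq a 0.
  rewrite expr0n mul0r.
  have -> : (fun s => second_difference v u p (s * 0) / s ^+ 2) = cst 0.
    apply/funext => s; rewrite /second_difference mulr0 scale0r addr0 subr0 /=.
    by rewrite (_ : v p + v p - 2 * v p = 0) ?mul0r//; ring.
  exact: cvg_cst.
have na : 0 < `|a| by rewrite normr_gt0.
have -> : (fun s => second_difference v u p (s * a) / s ^+ 2) =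
    (fun s => a ^+ 2 * (second_difference v u p (s * `|a|) / (s * `|a|) ^+ 2)).
  apply/funext => s.
  have -> : second_difference v u p (s * a) = second_difference v u p (s * `|a|).
    have [a1|a1] := leP 0 a; first by rewrite ger0_norm.
    rewrite ltr0_norm// mulrN /second_difference scaleNr opprK.
    by rewrite [v _ + v (p - _)]addrC.
  rewrite exprMn real_normK ?num_real//.
  have [->|s0] := eqVneq s 0; first by rewrite !expr0n /= !mul0r invr0 !mulr0.
  by field; rewrite s0 a0.
apply: cvgM; first exact: cvg_cst.
exact: (cvg_comp _ _ (cvg_scale_at_right na) h).
Qed.

Lemma ddx_second_difference (R : realType) (v : R * R -> R) p s :
  ddx v s p = second_difference v (1, 0) p s.
Proof.
by rewrite second_differenceE /ddx mulr1 mulr0 addr0 subr0.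
Qed.

(** Subtracting the horizontal and vertical parts from the second difference in
    the direction n leaves mixed differences of dx, which [dx_lipschitz]
    bounds. *)
Lemma mixed_second_derivative_bound (R : realType) (A B t D : R) (U : set (R * R))
    (v : R * R -> R) (n p : R * R) :
  0 < t -> flat_torsion A B t D v -> open U -> C2_on U v -> U p ->
  inset A B t 4 p ->
  `|D2 v n n p - (n.1 ^+ 2 * D2 v (1, 0) (1, 0) p + n.2 ^+ 2 * D2 v (0, 1) (0, 1) p)|
    <= 4 * D / t * (`|n.1| * `|n.2|).
Proof.
move=> t0 F oU C2 Up hp.
have L1 := second_difference_scale_cvg (a := n.1)
  (C2_second_difference_cvg (u := (1, 0)) oU C2 Up).
have L2 := second_difference_scale_cvg (a := n.2)
  (C2_second_difference_cvg (u := (0, 1)) oU C2 Up).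
have L := cvgB (C2_second_difference_cvg (u := n) oU C2 Up) (cvgD L1 L2).
apply: (cvg_at_right_norm_le (L _ _)); near=> s.
have s0 : 0 < s by near: s; exact: nbhs_right_gt.
have small (a : R) : s < t / (`|a| + 1) -> `|s * a| <= t.
  move=> h; rewrite normrM gtr0_norm//.
  have a1 : 0 < `|a| + 1 by rewrite ltr_wpDl.
  have : s * (`|a| + 1) <= t by rewrite -ler_pdivlMr// ltW.
  by rewrite mulrDr mulr1; linear.
have s1 : `|s * n.1| <= t.
  apply: small; near: s; apply: nbhs_right_lt; rewrite divr_gt0// ltr_wpDl//.
have s2 : `|s * n.2| <= t.
  apply: small; near: s; apply: nbhs_right_lt; rewrite divr_gt0// ltr_wpDl//.
have s1n : `|- (s * n.1)| <= t by rewrite normrN.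
have s2n : `|- (s * n.2)| <= t by rewrite normrN.
have hp3 : inset A B t 3 p by apply: inset_le hp; rewrite ?(ltW t0)//; linear.
have [_ M1] := dx_lipschitz t0 F s1 s2 hp3.
have [_ M2] := dx_lipschitz t0 F s1n s2n hp3.
set a := s * n.1 in s1 s1n M1 M2 *; set b := s * n.2 in s2 s2n M1 M2 *.
have E : second_difference v n p s / s ^+ 2 -
   (second_difference v (1, 0) p a / s ^+ 2 + second_difference v (0, 1) p b / s ^+ 2)
  = ((dx v a (p.1, p.2 + b) - dx v a p) + (dx v (- a) (p.1, p.2 - b) - dx v (- a) p)) / s ^+ 2.
  rewrite [n in second_difference v n]surjective_pairing !second_differenceE /dx /=.
  rewrite -/a -/b !mulr1 !mulr0 !addr0 !subr0; ring.
rewrite [X in `|X|]E normrM normfV (ger0_norm (sqr_ge0 _)) ler_pdivrMr ?exprn_gt0//.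
apply: le_trans (ler_normD _ _) _.
have ab : `|a| * `|b| = `|n.1| * `|n.2| * s ^+ 2.
  by rewrite /a /b !normrM (gtr0_norm s0); ring.
move: M1 M2; rewrite !normrN -!mulrA ab => M1 M2.
apply: le_trans (lerD M1 M2) _.
by rewrite le_eqVlt; apply/orP; left; apply/eqP; ring.
Unshelve. all: by end_near. Qed.

(** The cross term 2 K d |n_1| |n_2| is absorbed by the square
    (|n_1| - 2 K |n_2| / c) ^ 2.  This costs half of the horizontal part
    c d n_1 ^ 2 and, because 8 K ^ 2 d <= c, a quarter of n_2 ^ 2, of which the
    vertical part is at least one half. *)
Lemma quadratic_form_bounds (R : realType) (c K d h11 h22 hnn : R) (n : R * R) :
  0 < c -> 0 < K -> 0 < d <= 1 -> K * d <= 2^-1 -> 8 * K ^+ 2 * d <= c ->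
  unit_direction n -> h22 = -1 - h11 -> c * d <= - h11 -> - h11 <= K * d ->
  `|hnn - (n.1 ^+ 2 * h11 + n.2 ^+ 2 * h22)| <= 2 * (K * d) * (`|n.1| * `|n.2|) ->
  (2 * K + 10 + 4 / c)^-1 * Num.max (`|n.2| ^+ 2) d <= - hnn /\
  - hnn <= (2 * K + 10 + 4 / c) * Num.max (`|n.2| ^+ 2) d.
Proof.
move=> c0 K0 /andP[d0 d1] Kd Kc; rewrite /unit_direction.
rewrite -[n.1 ^+ 2]real_normK ?num_real// -[n.2 ^+ 2]real_normK ?num_real//.
move: (normr_ge0 n.1) (normr_ge0 n.2); set a := `|n.1|; set b := `|n.2|.
move=> a0 b0 ab -> lo up /ler_normlP[M1 M2].
have a1 : a ^+ 2 <= 1 by have := sqr_ge0 b; linear.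
have b1 : b ^+ 2 <= 1 by have := sqr_ge0 a; linear.
set m := Num.max _ _.
have mb : b ^+ 2 <= m by rewrite le_max lexx.
have md : d <= m by rewrite le_max lexx orbT.
have m1 : m <= 1 by rewrite ge_max b1 d1.
have m0 : 0 < m by exact: lt_le_trans md.
have C0 : 0 < 4 / c by rewrite divr_gt0.
have ab2 : 2 * (a * b) <= 1 by have := sqr_ge0 (a - b); rewrite sqrrB; linear.
have ab0 : 0 <= a * b by rewrite mulr_ge0.
have X1 : a ^+ 2 * (c * d) <= a ^+ 2 * - h11 by rewrite ler_wpM2l ?sqr_ge0.
have X2 : a ^+ 2 * - h11 <= a ^+ 2 * (K * d) by rewrite ler_wpM2l ?sqr_ge0.
have X3 : b ^+ 2 * 2^-1 <= b ^+ 2 * (1 + h11) by rewrite ler_wpM2l ?sqr_ge0//; linear.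
have X4 : b ^+ 2 * (1 + h11) <= b ^+ 2 * 1.
  rewrite ler_wpM2l ?sqr_ge0//; have : 0 < c * d by rewrite mulr_gt0. linear.
have Kd0 : 0 < K * d by rewrite mulr_gt0.
split.
  have am : 2 * (K * d) * (a * b) <= 2^-1 * c * d * a ^+ 2 + 4^-1 * b ^+ 2.
    have h1 : 0 <= d * (2^-1 * c * (a - 2 * K * b / c) ^+ 2).
      have c2 : 0 <= 2^-1 * c by linear.
      by rewrite mulr_ge0 ?(ltW d0)// mulr_ge0 ?sqr_ge0.
    have h2 : 8 * K ^+ 2 * d / (4 * c) * b ^+ 2 <= 4^-1 * b ^+ 2.
      rewrite ler_wpM2r ?sqr_ge0// ler_pdivrMr; last linear.
      linear.
    have h3 : d * (2^-1 * c * (a - 2 * K * b / c) ^+ 2) =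
      2^-1 * c * d * a ^+ 2 - 2 * (K * d) * (a * b) + 8 * K ^+ 2 * d / (4 * c) * b ^+ 2.
      by field; rewrite gt_eqF.
    linear.
  have X : 2^-1 * (c * d) * a ^+ 2 + 4^-1 * b ^+ 2 <= - hnn by linear.
  have cd0 : 0 < c * d by rewrite mulr_gt0.
  have Xp : 0 <= - hnn.
    by apply: le_trans X; rewrite addr_ge0// mulr_ge0 ?sqr_ge0//; linear.
  rewrite mulrC ler_pdivrMr; last linear.
  have KX : 0 <= K * - hnn by rewrite mulr_ge0// ltW.
  have CX : 0 <= 4 / c * - hnn by rewrite mulr_ge0// ltW.
  have [hb|hb] := leP 2^-1 (b ^+ 2).
    have : 0 <= 2^-1 * (c * d) * a ^+ 2 by rewrite mulr_ge0 ?sqr_ge0//; linear.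
    rewrite !mulrDr; linear.
  have ha : 2^-1 * (c * d) * 2^-1 <= 2^-1 * (c * d) * a ^+ 2.
    by rewrite ler_wpM2l//; linear.
  have [hm|hm] := leP (b ^+ 2) d.
    have mE : m = d by rewrite /m max_r.
    have : 4 / c * (4^-1 * (c * d)) <= 4 / c * - hnn.
      by rewrite ler_wpM2l ?(ltW C0)//; have := sqr_ge0 b; linear.
    have -> : 4 / c * (4^-1 * (c * d)) = d by field; rewrite gt_eqF.
    rewrite !mulrDr mE; linear.
  have mE : m = b ^+ 2 by rewrite /m max_l// ltW.
  rewrite !mulrDr mE; linear.
have Y1 : a ^+ 2 * (K * d) <= K * d.
  by rewrite -[leRHS]mul1r ler_wpM2r ?(ltW Kd0).
have Y2 : 2 * (K * d) * (a * b) <= K * d.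
  have := ler_wpM2l (ltW Kd0) ab2; linear.
have Y3 : K * d <= K * m by rewrite ler_wpM2l// ltW.
have Y4 : 0 < 4 / c * m by rewrite mulr_gt0.
linear.
Qed.

Lemma between_dist (R : realType) (a s x : R) :
  Num.min a (a + s) <= x <= Num.max a (a + s) -> `|x - a| <= `|s|.
Proof.
have [s0|s0] := leP 0 s.
  rewrite min_l ?max_r ?lerDl// => /andP[h1 h2].
  by rewrite (ger0_norm s0) ler_norml; linear.
have s0' : a + s <= a by linear.
rewrite min_r ?max_l// => /andP[h1 h2].
by rewrite (ltr0_norm s0) ler_norml; linear.
Qed.

(** The limit of [ddx_negativity_spread] for s tending to 0, with
    m = kappa d / 4.  The error d ^ 2 / 200 is at most half of what is gained,
    because d <= 100 c1. *)
Lemma second_derivative_negative (R : realType) (A B t d kappa rho c1 : R) (N : nat)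
    (O : set (R * R)) (v : R * R -> R) (p0 p : R * R) :
  0 < t -> 0 < d -> 0 < kappa -> 0 < rho <= t -> rho <= 3 * kappa * t ^+ 2 ->
  (0 < N)%N -> flat_torsion A B t (d / 100) v ->
  open O -> C2_on O v -> O p0 -> O p ->
  (forall s p, inset A B t 0 (p.1 + s, p.2) -> inset A B t 0 (p.1 - s, p.2) ->
    ddx v s p <= d ^+ 2 / 200 * s ^+ 2) ->
  inset A B t 8 p0 -> inset A B t 8 p ->
  D2 v (1, 0) (1, 0) p0 <= - (kappa * d) ->
  5 * (`|p.1 - p0.1| + `|p.2 - p0.2|) <= N%:R * rho ->
  c1 = (3 / 10) ^+ N * (kappa / 4) -> d <= 100 * c1 ->
  c1 / 2 * d <= - D2 v (1, 0) (1, 0) p.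
Proof.
move=> t0 d0 k0 rr rk N0 F oO C2 Op0 Op conc hp0 hp neg dist c1E dc1.
have L := C2_second_difference_cvg (u := (1, 0)) oO C2 Op.
have L0 := C2_second_difference_cvg (u := (1, 0)) oO C2 Op0.
have kd : 0 < kappa * d by rewrite mulr_gt0.
have near_t : \forall s \near (0 : R)^'+, `|s| <= t.
  near=> s.
  have s0 : 0 < s by near: s; exact: nbhs_right_gt.
  by rewrite gtr0_norm//; near: s; exact: nbhs_right_le.
have near0 : \forall s \near (0 : R)^'+, ddx v s p0 <= - (2 * (kappa * d / 4) * s ^+ 2).
  have h : D2 v (1, 0) (1, 0) p0 < - (kappa * d / 2).
    by apply: le_lt_trans neg _; clear -kd; linear.
  have h2 := cvgr_lt _ L0 _ h.
  near=> s; have s0 : 0 < s by near: s; exact: nbhs_right_gt.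
  have : second_difference v (1, 0) p0 s / s ^+ 2 < - (kappa * d / 2).
    by near: s; exact: (h2 _).
  rewrite ltr_pdivrMr ?exprn_gt0// ddx_second_difference => /ltW/le_trans; apply.
  by rewrite le_eqVlt; apply/orP; left; apply/eqP; field.
have t20 : 0 < t ^+ 2 by rewrite exprn_gt0.
have D0 : 0 <= d / 100 by rewrite divr_ge0// ltW.
have rm : 8 * (d / 100) / t ^+ 2 * rho <= kappa * d / 4.
  have h0 : 0 <= 8 * (d / 100) / t ^+ 2.
    by rewrite divr_ge0 ?(ltW t20)// mulr_ge0.
  apply: (le_trans (ler_wpM2l h0 rk)).
  have -> : 8 * (d / 100) / t ^+ 2 * (3 * kappa * t ^+ 2) = 24 / 100 * (kappa * d).
    by field; rewrite gt_eqF.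
  by clear -kd; linear.
have near1 : \forall s \near (0 : R)^'+,
    0 <= - (c1 / 2 * d) - second_difference v (1, 0) p s / s ^+ 2.
  near=> s.
  have s0 : 0 < s by near: s; exact: nbhs_right_gt.
  have st : `|s| <= t by near: s.
  have ns : ddx v s p0 <= - (2 * (kappa * d / 4) * s ^+ 2) by near: s.
  have e0 : 0 <= d ^+ 2 / 200 * s ^+ 2.
    exact: mulr_ge0 (divr_ge0 (sqr_ge0 d) (ler0n R 200)) (sqr_ge0 s).
  have he q : inset A B t 1 q -> ddx v s q <= d ^+ 2 / 200 * s ^+ 2.
    move=> hq; apply: conc.
      have := inset_shift (ltW t0) hq (_ : `|s| <= 1 * t) (_ : `|0 : R| <= 1 * t).
      by rewrite normr0 mul1r subrr addr0; apply => //; exact: ltW.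
    have := inset_shift (ltW t0) hq (_ : `|- s| <= 1 * t) (_ : `|0 : R| <= 1 * t).
    by rewrite normr0 normrN mul1r subrr addr0; apply => //; exact: ltW.
  have := ddx_negativity_spread t0 D0 F st rr rm he e0 hp0 hp ns N0 dist.
  have -> : (3 / 10) ^+ N * (kappa * d / 4 * s ^+ 2) = c1 * d * s ^+ 2 by rewrite c1E; ring.
  move=> h; rewrite -ddx_second_difference subr_ge0 ler_pdivrMr ?exprn_gt0//.
  apply: (le_trans h).
  have : d * d * s ^+ 2 <= 100 * c1 * d * s ^+ 2.
    by rewrite ler_wpM2r ?sqr_ge0// ler_wpM2r ?(ltW d0).
  by clear; linear.
have L' := cvgB (cvg_cst (- (c1 / 2 * d))) L.
have h : 0 <= - (c1 / 2 * d) - D2 v (1, 0) (1, 0) p.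
  exact: (cvg_at_right_ge0 (L' _ _) near1).
by rewrite lerNr -subr_ge0.
Unshelve. all: by end_near. Qed.

(** The constants depend only on M, tau and kappa: the number N of discs in the
    chain is bounded in terms of the length B - A <= 2 M of the rectangle and of
    the radius rho, for which [ddx_lipschitz] leaves half of the negativity of
    v_xx at p0. *)
Lemma hessian_bounds_flat (R : realType) (M tau kappa : R) :
  0 < M -> 0 < tau <= 1 / 10 -> 0 < kappa ->
  exists d0 C : R, [/\ 0 < d0, 0 < C &
  forall (A B d : R) (O : set (R * R)) (v : R * R -> R) (p0 : R * R),
    open O -> C2_on O v ->
    (forall p, O p -> {for p, continuous v} /\ laplacian v p = -1) ->
    (forall p, inset A B (tau / 8) 0 p -> O p) ->
    0 < d <= d0 -> B - A <= 2 * M ->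
    (forall p, inset A B (tau / 8) 0 p -> `|'D_(1, 0) v p| <= d / 100) ->
    (forall s p, inset A B (tau / 8) 0 (p.1 + s, p.2) ->
      inset A B (tau / 8) 0 (p.1 - s, p.2) -> ddx v s p <= d ^+ 2 / 200 * s ^+ 2) ->
    inset A B (tau / 8) 8 p0 -> D2 v (1, 0) (1, 0) p0 <= - (kappa * d) ->
  forall n, unit_direction n -> forall p, inset A B (tau / 8) 8 p ->
    C^-1 * Num.max (`|n.2| ^+ 2) d <= - D2 v n n p
    /\ - D2 v n n p <= C * Num.max (`|n.2| ^+ 2) d].
Proof.
move=> M0 /andP[tau0 tau1] k0.
pose t := tau / 8; have t0 : 0 < t by rewrite /t; linear.
pose K := 2 / (100 * t); have K0 : 0 < K by rewrite divr_gt0//; linear.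
pose rho := Num.min t (3 * kappa * t ^+ 2).
have r0 : 0 < rho.
  by rewrite /rho lt_min t0 /= !mulr_gt0// exprn_gt0.
have rt : rho <= t by rewrite /rho ge_min lexx.
have rk : rho <= 3 * kappa * t ^+ 2 by rewrite /rho ge_min lexx orbT.
pose X := 5 * (2 * M + 1) / rho.
have X0 : 0 < X by rewrite divr_gt0//; linear.
pose N := Num.bound X.
have XN : X < N%:R by apply: archi_boundP; exact: ltW.
have N0 : (0 < N)%N by rewrite -(ltr_nat R) (lt_trans X0).
pose c1 := (3 / 10) ^+ N * (kappa / 4).
have c10 : 0 < c1 by rewrite mulr_gt0 ?exprn_gt0//; linear.
pose c := c1 / 2; have c0 : 0 < c by rewrite /c; linear.
pose d0 := Num.min (Num.min 1 (2^-1 / K)) (Num.min (c / (8 * K ^+ 2)) (100 * c1)).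
have K20 : 0 < 8 * K ^+ 2 by rewrite mulr_gt0// exprn_gt0.
exists d0, (2 * K + 10 + 4 / c); split.
- by rewrite /d0 !lt_min ltr01 !divr_gt0//= mulr_gt0.
- have : 0 < 4 / c by rewrite divr_gt0. linear.
move=> A B d O v p0 oO C2 vO QO /andP[d0p dd0] AB Dv conc hp0 neg n un p hp.
have [d1 dK dc dc1] : [/\ d <= 1, K * d <= 2^-1, 8 * K ^+ 2 * d <= c & d <= 100 * c1].
  move: dd0; rewrite /d0 !le_min => /andP[/andP[h1 h2] /andP[h3 h4]].
  split => //; first by rewrite mulrC -ler_pdivlMr.
  by rewrite mulrC -ler_pdivlMr.
have F : flat_torsion A B t (d / 100) v.
  split.
    move=> q /QO Oq; have [cq lq] := vO q Oq; split => //.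
    by rewrite -lq; exact: (C2_has_laplacian oO C2 Oq).
  move=> s q st hq; apply: dx_bound => x hx.
  have xq : inset A B t 0 (x, q.2).
    apply: (@inset_le _ _ _ _ (1 - 1)); [exact: ltW|linear|].
    apply: inset_near hq _ _ => /=; rewrite ?mul1r ?subrr ?normr0 ?(ltW t0)//.
    exact: le_trans (between_dist hx) st.
  split; last exact: Dv.
  exact: C2_derivable C2 (QO _ xq).
have Op : O p by apply: QO; apply: inset_le hp; rewrite ?(ltW t0)//; linear.
have Op0 : O p0 by apply: QO; apply: inset_le hp0; rewrite ?(ltW t0)//; linear.
have L := C2_second_difference_cvg (u := (1, 0)) oO C2 Op.
have hp4 : inset A B t 4 p by apply: inset_le hp; rewrite ?(ltW t0)//; linear.
have Kd : 2 * (d / 100) / t = K * d by rewrite /K; field; rewrite gt_eqF.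
have near_t : \forall s \near (0 : R)^'+, `|s| <= t.
  near=> s.
  have s0 : 0 < s by near: s; exact: nbhs_right_gt.
  by rewrite gtr0_norm//; near: s; exact: nbhs_right_le.
have up : `|D2 v (1, 0) (1, 0) p| <= K * d.
  apply: (cvg_at_right_norm_le L); near=> s.
  have s0 : 0 < s by near: s; exact: nbhs_right_gt.
  have st : `|s| <= t by near: s.
  rewrite -ddx_second_difference normrM normfV (ger0_norm (sqr_ge0 s)).
  by rewrite ler_pdivrMr ?exprn_gt0// -Kd; exact: ddx_bound F st hp4.
have dist : 5 * (`|p.1 - p0.1| + `|p.2 - p0.2|) <= N%:R * rho.
  have h1 : 5 * (2 * M + 1) <= N%:R * rho by rewrite -ler_pdivrMr// ltW.
  apply: le_trans h1; rewrite ler_pM2l//; apply: lerD.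
    move: hp hp0 => [/andP[a1 a2] _] [/andP[b1 b2] _].
    by rewrite ler_norml; move: a1 a2 b1 b2 AB; rewrite -/t; clear -t0; linear.
  move: hp hp0 => [_ /andP[a1 a2]] [_ /andP[b1 b2]].
  by rewrite ler_norml; move: a1 a2 b1 b2; rewrite -/t; clear -t0; linear.
have lo : c * d <= - D2 v (1, 0) (1, 0) p.
  have rr : 0 < rho <= t by rewrite r0 rt.
  exact: (second_derivative_negative t0 d0p k0 rr rk N0 F oO C2 Op0 Op conc
    hp0 hp neg dist (erefl _) dc1).
have dd : 0 < d <= 1 by rewrite d0p d1.
have lE := (vO p Op).2; rewrite /laplacian in lE.
have h22 : D2 v (0, 1) (0, 1) p = -1 - D2 v (1, 0) (1, 0) p.
  by rewrite -(addKr (D2 v (1, 0) (1, 0) p) (D2 v (0, 1) (0, 1) p)) lE addrC.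
have up' : - D2 v (1, 0) (1, 0) p <= K * d by move/ler_normlP : up => [].
apply: (quadratic_form_bounds c0 K0 dd dK dc un h22 lo up').
have -> : 2 * (K * d) = 4 * (d / 100) / t by rewrite -Kd; ring.
exact: mixed_second_derivative_bound t0 F oO C2 Op hp4.
Unshelve. all: by end_near. Qed.

(** * The torsion function of a normalised region *)

Lemma closure_mix (R : realType) (A : set (R * R)) (l : R) :
  (forall z1 z2, A z1 -> A z2 -> A (mix l z1 z2)) ->
  forall z1 z2, closure A z1 -> closure A z2 -> closure A (mix l z1 z2).
Proof.
move=> cA z1 z2 c1 c2 B nB.
have := @continuous_combination R (1 - l) l (z1, z2) B nB.
move=> [[Q1 Q2] /= [n1 n2] HQ].
have [y1 [Ay1 Qy1]] := c1 _ n1; have [y2 [Ay2 Qy2]] := c2 _ n2.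
by exists (mix l y1 y2); split; [exact: cA|exact: (HQ (y1, y2))].
Qed.

(** With y close to z2, the map q |-> (1 - l)^-1 q - l (1 - l)^-1 y, whose inverse
    is q |-> mix l q y, sends a neighbourhood of [mix l z1 z2] into A. *)
Lemma interior_mix (R : realType) (A : set (R * R)) (l : R) :
  l < 1 -> (forall z1 z2, A z1 -> A z2 -> A (mix l z1 z2)) ->
  forall z1 z2, A° z1 -> closure A z2 -> A° (mix l z1 z2).
Proof.
move=> l1 cA z1 z2 n1 c2.
have l10 : 1 - l != 0 by rewrite subr_eq0 gt_eqF.
pose g (q : (R * R) * (R * R)) : R * R :=
  ((1 - l)^-1 * q.1.1 + (- l / (1 - l)) * q.2.1,
   (1 - l)^-1 * q.1.2 + (- l / (1 - l)) * q.2.2).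
have gz : g (mix l z1 z2, z2) = z1.
  by rewrite /g /mix [RHS]surjective_pairing /=; congr (_, _); field.
have n1' : nbhs (g (mix l z1 z2, z2)) A by rewrite gz; exact: n1.
have := @continuous_combination R (1 - l)^-1 (- l / (1 - l)) (mix l z1 z2, z2) A n1'.
move=> [[Q Y] /= [nQ nY] HQ].
have [y [Ay Yy]] := c2 _ nY.
apply: filterS nQ => q Qq.
have := cA _ _ (HQ (q, y) (conj Qq Yy)) Ay; congr A.
by rewrite /mix [RHS]surjective_pairing /=; congr (_, _); field.
Qed.

Lemma convex_functionE (R : realType) (a b : R) (f : R -> R) :
  convex_function (`[a, b] : set R) f ->
  forall x y l, a <= x <= b -> a <= y <= b -> 0 <= l <= 1 ->
    f ((1 - l) * x + l * y) <= (1 - l) * f x + l * f y.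
Proof.
move=> cf x y l hx hy /andP[l0 l1].
have := cf (Itv01 l0 l1) y x; rewrite !inE /= !in_itv /= => /(_ hy hx).
move=> H; rewrite (addrC _ (l * y)) (addrC _ (l * f y)); exact: H.
Qed.

Lemma region_mix (R : realType) (P : profile R) (l : R) :
  normalised P -> 0 <= l <= 1 ->
  forall z1 z2, region P z1 -> region P z2 -> region P (mix l z1 z2).
Proof.
move=> [_ [c1 c2] _ _ _] /andP[l0 l1] z1 z2 [x1 /andP[y1 y1']] [x2 /andP[y2 y2']].
have l01 : 0 <= l <= 1 by rewrite l0 l1.
have h1 := convex_functionE c1 x1 x2 l01.
have h2 := convex_functionE c2 x1 x2 l01.
have l1' : 0 <= 1 - l by rewrite subr_ge0.
have m a b c d : a <= b -> c <= d -> (1 - l) * a + l * c <= (1 - l) * b + l * d :> R.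
  by move=> ? ?; apply: lerD; rewrite ler_wpM2l.
move: x1 x2 => /andP[x1 x1'] /andP[x2 x2'].
have k1 := m _ _ _ _ x1 x2; have k2 := m _ _ _ _ x1' x2'.
have k3 := m _ _ _ _ y1 y2; have k4 := m _ _ _ _ y1' y2'.
by split => /=; apply/andP; split; linear.
Qed.

Lemma region_closure_rectangle (R : realType) (P : profile R) :
  normalised P ->
  closure (region P) `<=` [set p | (pa P <= p.1 <= pb P) /\ (0 <= p.2 <= 1)].
Proof.
move=> [_ _ bd _ _].
have cl : closed [set p : R * R | (pa P <= p.1 <= pb P) /\ (0 <= p.2 <= 1)].
  by apply: compact_closed (@compact_rectangle _ _ _ _ _); exact: norm_hausdorff.
rewrite [X in _ `<=` X]((closure_id _).1 cl); apply: closure_subset => p [hx /andP[h1 h2]].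
have hx' : p.1 \in `[pa P, pb P] by rewrite in_itv.
have [b1 b2 b3] := bd p.1 hx'.
by split => //; apply/andP; split; linear.
Qed.

Lemma region_closure_compact (R : realType) (P : profile R) :
  normalised P -> compact (closure (region P)).
Proof.
move=> nP; apply: subclosed_compact (region_closure_rectangle nP).
  exact: closed_closure.
exact: compact_rectangle.
Qed.

Lemma torsion_continuous_at (R : realType) (A : set (R * R)) (v : R * R -> R) p :
  torsion_function A v -> A° p -> {for p, continuous v}.
Proof.
move=> [_ _ cv _] Ap.
have /subspace_continuousP/(_ p (subset_closure (interior_subset Ap))) := cv.
rewrite within_interior//.
by apply: filterS Ap => q; exact: subset_closure.
Qed.

Lemma torsion_has_laplacian (R : realType) (A : set (R * R)) (v : R * R -> R) p :
  torsion_function A v -> A° p -> has_laplacian v p (-1).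
Proof.
move=> [C2 lv _ _] Ap; rewrite -(lv p Ap).
exact: C2_has_laplacian (open_interior A) C2 Ap.
Qed.

Lemma torsion_ge0 (R : realType) (P : profile R) (v : R * R -> R) :
  normalised P -> torsion_function (region P) v ->
  forall p, closure (region P) p -> 0 <= v p.
Proof.
move=> nP tv; have [_ _ cv vb] := tv.
apply: minimum_principle (region_closure_compact nP) cv _ => p cp.
have [ip|nip] := pselect ((region P)° p); last by left; rewrite vb.
right; split; first exact: interiorS (@subset_closure _ _) _ ip.
by exists (-1); [rewrite lerN10|exact: torsion_has_laplacian tv ip].
Qed.

(** Comparison with the torsion function of the strip 0 <= y <= 1. *)
Lemma torsion_le_strip (R : realType) (P : profile R) (v : R * R -> R) :
  normalised P -> torsion_function (region P) v ->
  forall p, closure (region P) p -> v p <= p.2 * (1 - p.2) / 2.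
Proof.
move=> nP tv; have [_ _ cv vb] := tv.
suff H p : closure (region P) p -> 0 <= 1 * (p.2 * (1 - p.2) / 2) + (-1) * v p.
  by move=> p /H; linear.
apply: (minimum_principle (w := fun p => 1 * (p.2 * (1 - p.2) / 2) + (-1) * v p)
  (region_closure_compact nP)).
  apply: within_continuousD.
    by apply: continuous_subspaceT; continuous_polynomial.
  by apply: within_continuousM => // q; exact: cvg_cst.
move=> {}p cp; have [ip|nip] := pselect ((region P)° p).
  right; split; first exact: interiorS (@subset_closure _ _) _ ip.
  exists (1 * -1 + -1 * -1); first linear.
  apply: has_laplacian_lin; last exact: torsion_has_laplacian tv ip.
  by apply: (@has_laplacian_poly _ _ _ _ 0) => s; rewrite /stencil /=; field.
left; rewrite vb//.
have [_ /andP[h1 h2]] := region_closure_rectangle nP cp.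
have : 0 <= p.2 * (1 - p.2) by rewrite mulr_ge0// subr_ge0.
linear.
Qed.

Lemma torsion_gt0 (R : realType) (P : profile R) (v : R * R -> R) :
  normalised P -> torsion_function (region P) v ->
  forall p, (region P)° p -> 0 < v p.
Proof.
move=> nP tv p ip.
have cp : closure (region P) p by exact: subset_closure (interior_subset ip).
have v0 := torsion_ge0 nP tv.
rewrite lt_neqAle v0// andbT; apply/negP => /eqP vp.
have : (0 : R) <= -1.
  apply: has_laplacian_ge0 (torsion_has_laplacian tv ip) _; near=> s.
  have [h1 h2 h3 h4] : [/\ closure (region P) (p.1 + s, p.2),
      closure (region P) (p.1 - s, p.2), closure (region P) (p.1, p.2 + s) &
      closure (region P) (p.1, p.2 - s)].
    near: s; apply: near_shift_interior.
    exact: interiorS (@subset_closure _ _) _ ip.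
  by rewrite /stencil -vp mulr0 subr0 !addr_ge0// v0.
by rewrite ler0N1.
Unshelve. all: by end_near. Qed.

Lemma sqrt_torsion_concave (R : realType) (P : profile R) (v : R * R -> R) (l : R) :
  normalised P -> torsion_function (region P) v -> 0 < l < 1 ->
  forall z1 z2, closure (region P) z1 -> closure (region P) z2 ->
    (1 - l) * Num.sqrt (v z1) + l * Num.sqrt (v z2) <= Num.sqrt (v (mix l z1 z2)).
Proof.
move=> nP tv l01; have /andP[l0 l1] := l01; have [C2 _ cv vb] := tv.
have rm := region_mix nP (_ : 0 <= l <= 1).
have rm' := region_mix nP (_ : 0 <= 1 - l <= 1).
have {}rm : forall z1 z2, region P z1 -> region P z2 -> region P (mix l z1 z2).
  by apply: rm; rewrite !ltW.
have {}rm' : forall z1 z2, region P z1 -> region P z2 -> region P (mix (1 - l) z1 z2).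
  by apply: rm'; apply/andP; split; linear.
apply: (@sqrt_torsion_concave_interior _ _ (region P)° _ _ (region_closure_compact nP)) => //.
- exact: open_interior.
- by move=> p /interior_subset; exact: subset_closure.
- exact: torsion_ge0 nP tv.
- by move=> p cp nip; apply: vb.
- move=> p ip; split; first exact: torsion_gt0 nP tv p ip.
    exact: torsion_has_laplacian tv ip.
  by move=> e; exact: C2_derivable C2 ip.
- exact: closure_mix rm.
- move=> z1 z2 c1 c2 [i1|i2]; first exact: (interior_mix l1 rm i1 c2).
  rewrite mix_swap.
  by apply: (interior_mix _ rm' i2 c1); linear.
Qed.

(** * The height function *)

Lemma normalised_values (R : realType) (P : profile R) x :
  normalised P -> pa P <= x <= pb P ->
  [/\ 0 <= f1 P x, f1 P x <= f2 P x, f2 P x <= 1 & height P x <= 1].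
Proof.
move=> [_ _ bd [hb _] _] hx; have hx' : x \in `[pa P, pb P] by rewrite in_itv.
by have [h1 h2 h3] := bd x hx'; split=> //; exact: hb.
Qed.

Lemma height_concave (R : realType) (P : profile R) x y l :
  normalised P -> pa P <= x <= pb P -> pa P <= y <= pb P -> 0 <= l <= 1 ->
  (1 - l) * height P x + l * height P y <= height P ((1 - l) * x + l * y).
Proof.
move=> [_ [c1 c2] _ _ _] hx hy hl.
have := convex_functionE c1 hx hy hl; have := convex_functionE c2 hx hy hl.
by rewrite /height; linear.
Qed.

(** Both terms of [Error] are nonnegative, and its supremum is one of a set with
    the upper bound 1. *)
Lemma error_controls (R : realType) (c1 C1 e : R) (P : profile R) (x0 : R) :
  normalised P -> 0 < c1 -> 0 < C1 -> pa P <= x0 <= pb P ->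
  Error c1 C1 P x0 <= e ->
  C1 * expR (- c1 * end_distance P x0) <= e /\
  forall x, `|x - x0| <= 3 / 4 * end_distance P x0 ->
    C1 * (expR (- c1 * `|x - x0|) * `|height P x - height P x0|) <= e.
Proof.
move=> nP c10 C10 hx0; rewrite /Error.
set S := [set _ | _ in _]; set d := end_distance P x0.
have d0 : 0 <= d by rewrite /d /end_distance le_min; linear.
have near_in x : `|x - x0| <= 3 / 4 * d -> pa P <= x <= pb P.
  have da : d <= x0 - pa P by rewrite /d /end_distance ge_min lexx.
  have db : d <= pb P - x0 by rewrite /d /end_distance ge_min lexx orbT.
  by rewrite ler_norml => /andP[h1 h2]; linear.
have ubS : has_ubound S.
  exists 1 => _ [x /= hx <-].
  have [a1 a2 a3 a4] := normalised_values nP (near_in x hx).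
  have [b1 b2 b3 b4] := normalised_values nP hx0.
  have k1 : expR (- c1 * `|x - x0|) <= 1.
    by rewrite -expR0 ler_expR mulNr oppr_le0 mulr_ge0// ltW.
  have k2 : `|height P x - height P x0| <= 1.
    by rewrite ler_norml; move: a4 b4; rewrite /height; linear.
  by rewrite -[leRHS]mulr1; apply: ler_pM => //; exact: expR_ge0.
have S0 : 0 <= sup S.
  apply: ub_le_sup => //; exists x0 => /=; first by rewrite subrr normr0 mulr_ge0.
  by rewrite !subrr normr0 mulr0.
have E0 : 0 <= C1 * expR (- c1 * d) by rewrite mulr_ge0 ?expR_ge0// ltW.
have CS0 : 0 <= C1 * sup S by rewrite mulr_ge0// ltW.
move=> h; split; first by linear.
move=> x hx; have : expR (- c1 * `|x - x0|) * `|height P x - height P x0| <= sup S.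
  by apply: ub_le_sup => //; exists x.
rewrite -(ler_pM2l C10); linear.
Qed.

(** The first term of [Error] at xbar forces the ends of the region to be far
    away.  The second one then bounds 1 - h at xbar + 2 M and xbar - 2 M, and by
    concavity the bound holds in between. *)
Lemma long_and_flat (R : realType) (c1 C1 M d : R) (P : profile R) (xbar : R) :
  normalised P -> 0 < c1 -> 0 < C1 -> 0 < M -> pa P <= xbar <= pb P ->
  height P xbar = 1 -> Error c1 C1 P xbar <= d / 100 ->
  d <= 100 * C1 * expR (- c1 * (4 * M)) ->
  pa P + 4 * M <= xbar <= pb P - 4 * M /\
  forall x, xbar - 2 * M <= x <= xbar + 2 * M ->
    1 - height P x <= expR (c1 * (2 * M)) / (100 * C1) * d.
Proof.
move=> nP c10 C10 M0 hx hbar Ed dM.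
have [E1 E2] := error_controls nP c10 C10 hx Ed.
have d4 : 4 * M <= end_distance P xbar.
  have : C1 * expR (- c1 * end_distance P xbar) <= C1 * expR (- c1 * (4 * M)).
    by apply: le_trans E1 _; linear.
  by rewrite ler_pM2l// ler_expR !mulNr lerN2 ler_pM2l.
have da : end_distance P xbar <= xbar - pa P by rewrite /end_distance ge_min lexx.
have db : end_distance P xbar <= pb P - xbar by rewrite /end_distance ge_min lexx orbT.
split; first linear.
set H := expR _ / _.
have ends x : `|x - xbar| = 2 * M -> 1 - height P x <= H * d.
  move=> xM; have := E2 x; rewrite xM hbar => h.
  have {}h := h (_ : 2 * M <= 3 / 4 * end_distance P xbar).
  have {}h : C1 * (expR (- c1 * (2 * M)) * `|height P x - 1|) <= d / 100 by apply: h; linear.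
  have k : 1 - height P x <= `|height P x - 1| by rewrite distrC; exact: ler_norm.
  apply: (le_trans k).
  have e0 : 0 < expR (c1 * (2 * M)) by exact: expR_gt0.
  have -> : H * d = expR (c1 * (2 * M)) / C1 * (d / 100) by rewrite /H; field; rewrite gt_eqF.
  have -> : `|height P x - 1| = expR (c1 * (2 * M)) / C1 *
      (C1 * (expR (- c1 * (2 * M)) * `|height P x - 1|)).
    rewrite mulNr expRN; field; rewrite !gt_eqF//.
  by rewrite ler_wpM2l// divr_ge0// ltW.
have inP y : xbar - 2 * M <= y <= xbar + 2 * M -> pa P <= y <= pb P by move=> ?; linear.
have hr : 1 - height P (xbar + 2 * M) <= H * d.
  by apply: ends; rewrite addrAC subrr add0r ger0_norm//; linear.
have hl : 1 - height P (xbar - 2 * M) <= H * d.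
  by apply: ends; rewrite addrAC subrr add0r normrN ger0_norm//; linear.
move=> x hxJ.
have M20 : 0 < 2 * M by linear.
have interp e : pa P <= e <= pb P -> 1 - height P e <= H * d -> forall l, 0 <= l <= 1 ->
    1 - height P ((1 - l) * xbar + l * e) <= H * d.
  move=> he hHd l hl01; have := height_concave nP hx he hl01; rewrite hbar.
  have [_ _ _ he1] := normalised_values nP he.
  move: hl01 => /andP[l0 l1].
  have : l * (1 - height P e) <= 1 * (1 - height P e).
    by apply: ler_wpM2r => //; rewrite subr_ge0.
  linear.
have [xr|xl] := leP xbar x.
  have -> : x = (1 - (x - xbar) / (2 * M)) * xbar + (x - xbar) / (2 * M) * (xbar + 2 * M).
    by field; rewrite gt_eqF.
  apply: interp => //; first by apply: inP; linear.
  by rewrite divr_ge0 ?ler_pdivrMr//=; linear.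
have -> : x = (1 - (xbar - x) / (2 * M)) * xbar + (xbar - x) / (2 * M) * (xbar - 2 * M).
  by field; rewrite gt_eqF.
apply: interp => //; first by apply: inP; linear.
by rewrite divr_ge0 ?ler_pdivrMr//=; linear.
Qed.

(** A concave function with values in [1 - e, 1] on an interval has slopes of
    size at most e / M at distance M from the ends. *)
Lemma height_lipschitz (R : realType) (M e : R) (P : profile R) (xbar : R) :
  normalised P -> 0 < M ->
  pa P <= xbar - 2 * M -> xbar + 2 * M <= pb P ->
  (forall x, xbar - 2 * M <= x <= xbar + 2 * M -> 1 - height P x <= e) ->
  forall x y, xbar - M <= x <= xbar + M -> xbar - M <= y <= xbar + M ->
    height P x - height P y <= e / M * `|x - y|.
Proof.
move=> nP M0 pl pr flat x y hx hy.
have inP z : xbar - 2 * M <= z <= xbar + 2 * M -> pa P <= z <= pb P by move=> ?; linear.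
have e0 : 0 <= e.
  have hx2 : xbar - 2 * M <= x <= xbar + 2 * M by linear.
  have [_ _ _ h] := normalised_values nP (inP x hx2).
  by have := flat x hx2; linear.
(* applied below to the end z of the large interval beyond y *)
have interp z : xbar - 2 * M <= z <= xbar + 2 * M -> forall l, 0 <= l <= 1 ->
    y = (1 - l) * x + l * z -> height P x - height P y <= l * e.
  move=> hz l hl ->.
  have hx2 : xbar - 2 * M <= x <= xbar + 2 * M by linear.
  have := height_concave nP (inP x hx2) (inP z hz) hl.
  have [_ _ _ h] := normalised_values nP (inP x hx2).
  move: hl => /andP[l0 l1].
  have : l * (height P x - height P z) <= l * e.
    by rewrite ler_wpM2l//; have := flat z hz; linear.
  linear.
have weight (a b : R) : 0 <= a -> M <= b -> a / b * e <= e / M * a.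
  move=> a0 Mb; have -> : a / b * e = (e * a) / b by ring.
  have -> : e / M * a = (e * a) / M by ring.
  by rewrite ler_wpM2l ?mulr_ge0// lef_pV2 ?posrE//; linear.
have [xy|yx] := leP x y.
  rewrite distrC ger0_norm ?subr_ge0//.
  have b0 : M <= xbar + 2 * M - x by linear.
  have b1 : 0 < xbar + 2 * M - x by linear.
  apply: le_trans (weight (y - x) _ _ b0); last by rewrite subr_ge0.
  apply: (interp (xbar + 2 * M)); first linear.
    by rewrite divr_ge0 ?ler_pdivrMr//=; linear.
  by field; rewrite gt_eqF.
rewrite gtr0_norm ?subr_gt0//.
have b0 : M <= x - (xbar - 2 * M) by linear.
have b1 : 0 < x - (xbar - 2 * M) by linear.
apply: le_trans (weight (x - y) _ _ b0); last by rewrite subr_ge0 ltW.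
apply: (interp (xbar - 2 * M)); first linear.
  by rewrite divr_ge0 ?ler_pdivrMr//=; linear.
by field; rewrite gt_eqF.
Qed.

(** * Regions that are close to a strip *)

(** What the assumptions on the region and on [Error] provide.  The number H
    depends only on M and on the constants in the estimate of v, whereas d may
    be arbitrarily small. *)
Record almost_strip (R : realType) (P : profile R) (v : R * R -> R)
    (M H d xbar xm xp : R) : Prop := AlmostStrip {
  as_normalised : normalised P;
  as_torsion : torsion_function (region P) v;
  as_length : 2 < M;
  as_delta : 0 < d <= 1 / 10;
  as_flatness : 0 < H /\ H * d <= 1 / 20;
  as_left_end : pa P + 4 * M <= xbar;
  as_right_end : xbar + 4 * M <= pb P;
  as_peak : height P xbar = 1;
  as_flat : forall x, xbar - 2 * M <= x <= xbar + 2 * M -> 1 - height P x <= H * d;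
  as_left : xbar - M <= xm <= xbar;
  as_right : xbar <= xp <= xbar + M;
  as_height_left : height P xm = 1 - 2 * d;
  as_height_right : height P xp = 1 - 2 * d;
  as_estimate : forall x y, xm <= x <= xp -> 1 / 5 <= y <= 4 / 5 ->
    `|v (x, y) - v1 P (x, y)| <= d / 100 /\ `|'D_(1, 0) v (x, y)| <= d / 100 }.

Lemma as_values (R : realType) (P : profile R) (v : R * R -> R)
    (M H d xbar xm xp : R) (S : almost_strip P v M H d xbar xm xp) x :
  xbar - 2 * M <= x <= xbar + 2 * M ->
  [/\ pa P <= x <= pb P, 0 <= f1 P x <= 1 / 20, 19 / 20 <= f2 P x <= 1,
      height P x <= 1 & 19 / 20 <= height P x].
Proof.
move=> hx; have M2 := as_length S.
have hP : pa P <= x <= pb P by have := as_left_end S; have := as_right_end S; linear.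
have [h1 h2 h3 h4] := normalised_values (as_normalised S) hP.
have hflat := as_flat S hx; have [_ hd] := as_flatness S.
by split => //; move: h4 hflat; rewrite /height; linear.
Qed.

Lemma as_mid_range (R : realType) (P : profile R) (v : R * R -> R)
    (M H d xbar xm xp : R) (S : almost_strip P v M H d xbar xm xp) x :
  xm <= x <= xp -> xbar - M <= x <= xbar + M.
Proof. by have := as_left S; have := as_right S; linear. Qed.

Lemma as_wide_range (R : realType) (P : profile R) (v : R * R -> R)
    (M H d xbar xm xp : R) (S : almost_strip P v M H d xbar xm xp) x :
  xbar - M <= x <= xbar + M -> xbar - 2 * M <= x <= xbar + 2 * M.
Proof. by have := as_length S; linear. Qed.

Lemma as_interior (R : realType) (P : profile R) (v : R * R -> R)
    (M H d xbar xm xp : R) (S : almost_strip P v M H d xbar xm xp) x y :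
  xbar - M <= x <= xbar + M -> 1 / 20 < y < 19 / 20 ->
  (region P)° (x, y).
Proof.
move=> hx hy; have M2 := as_length S.
have sub : [set p | (xbar - 2 * M <= p.1 <= xbar + 2 * M) /\
    (1 / 20 <= p.2 <= 19 / 20)] `<=` region P.
  move=> p [hp1 hp2]; have [k1 k2 k3 _ _] := as_values S hp1.
  by split => //; linear.
by apply: (interiorS sub); apply: interior_rectangle => /=; linear.
Qed.

Lemma v1_le_height (R : realType) (P : profile R) x y : v1 P (x, y) <= height P x ^+ 2 / 8.
Proof.
rewrite /v1 /height /=; have := sqr_ge0 (2 * y - f1 P x - f2 P x); linear.
Qed.

Lemma as_center (R : realType) (P : profile R) (v : R * R -> R)
    (M H d xbar xm xp : R) (S : almost_strip P v M H d xbar xm xp) :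
  1 / 8 - d / 100 <= v (xbar, 1 / 2).
Proof.
have [M2 /andP[d0 _]] := (as_length S, as_delta S).
have hb : xm <= xbar <= xp by have := as_left S; have := as_right S; linear.
have hy : 1 / 5 <= (1 / 2 : R) <= 4 / 5 by linear.
have [E _] := as_estimate S hb hy.
have hx : xbar - 2 * M <= xbar <= xbar + 2 * M by linear.
have hP : pa P <= xbar <= pb P by have := as_left_end S; have := as_right_end S; linear.
have [k1 k2 k3 k4] := normalised_values (as_normalised S) hP.
have hb1 := as_peak S; rewrite /height in hb1.
have f10 : f1 P xbar = 0 by linear.
have f21 : f2 P xbar = 1 by linear.
move: E; rewrite /v1 /= f10 f21 ler_norml; linear.
Qed.

(** The bound by the strip y (1 - y) / 2 puts y close to 1/2.  Then the estimate of
    v applies, and v <= h ^ 2 / 8 + d / 100 <= h / 8 + d / 100. *)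
Lemma as_near_maximum (R : realType) (P : profile R) (v : R * R -> R)
    (M H d xbar xm xp : R) (S : almost_strip P v M H d xbar xm xp) x y :
  xm <= x <= xp -> region P (x, y) ->
  1 / 8 - d / 100 <= v (x, y) ->
  1 - d / 5 <= height P x /\ `|y - 1 / 2| <= 1 / 20.
Proof.
move=> hx rxy hv; have /andP[d0 d1] := as_delta S.
have := torsion_le_strip (as_normalised S) (as_torsion S) (subset_closure rxy).
rewrite /= => hstrip.
have y2 : (y - 1 / 2) ^+ 2 <= (1 / 20) ^+ 2.
  have -> : (y - 1 / 2) ^+ 2 = 1 / 4 - y * (1 - y) by field.
  linear.
have yn : `|y - 1 / 2| <= 1 / 20 by apply: sqr_le_abs => //; linear.
split => //; move: yn; rewrite ler_norml => yn.
have hy : 1 / 5 <= y <= 4 / 5 by linear.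
have [/ler_normlP[_ E] _] := as_estimate S hx hy.
have hw := as_wide_range S (as_mid_range S hx).
have [_ _ _ h1 h2] := as_values S hw.
have := v1_le_height P x y.
have : height P x ^+ 2 <= height P x by rewrite expr2 -[leRHS]mul1r ler_wpM2r//; linear.
linear.
Qed.

Lemma as_lipschitz (R : realType) (P : profile R) (v : R * R -> R)
    (M H d xbar xm xp : R) (S : almost_strip P v M H d xbar xm xp) x y :
  xm <= x <= xp -> xm <= y <= xp ->
  height P x - height P y <= H * d * `|x - y|.
Proof.
move=> /(as_mid_range S) hx /(as_mid_range S) hy; have M2 := as_length S.
have M0 : 0 < M by linear.
have L := height_lipschitz (as_normalised S) M0 _ _ (as_flat S) hx hy.
have {}L : height P x - height P y <= H * d / M * `|x - y|.
  by apply: L; have := as_left_end S; have := as_right_end S; linear.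
apply: (le_trans L); rewrite ler_wpM2r// ler_pdivrMr//.
have [H0 _] := as_flatness S; have /andP[d0 _] := as_delta S.
have Hd : 0 < H * d by rewrite mulr_gt0.
by rewrite ler_peMr ?(ltW Hd)//; linear.
Qed.

(** At the ends of [xm, xp] the height is 1 - 2 d, and its slopes are at most
    H d. *)
Lemma as_margin (R : realType) (P : profile R) (v : R * R -> R)
    (M H d xbar xm xp : R) (S : almost_strip P v M H d xbar xm xp) x e :
  xm <= x <= xp -> 1 - e * d <= height P x ->
  xm + (2 - e) / H <= x <= xp - (2 - e) / H.
Proof.
move=> hx hh; have [H0 _] := as_flatness S; have /andP[d0 _] := as_delta S.
have hl := as_left S; have hr := as_right S.
have Lp : height P x - height P xp <= H * d * `|x - xp| by apply: (as_lipschitz S) => //; linear.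
have Lm : height P x - height P xm <= H * d * `|x - xm| by apply: (as_lipschitz S) => //; linear.
move: Lp Lm; rewrite (as_height_left S) (as_height_right S).
have xp1 : `|x - xp| = xp - x by rewrite distrC ger0_norm//; linear.
have xm1 : `|x - xm| = x - xm by rewrite ger0_norm//; linear.
rewrite xp1 xm1 => Lp Lm.
have aux z : (2 - e) * d <= H * d * z -> (2 - e) / H <= z.
  move=> hz; rewrite ler_pdivrMr// -(ler_pM2r d0).
  by rewrite (_ : z * H * d = H * d * z)//; ring.
have p1 : (2 - e) / H <= xp - x by apply: aux; linear.
have m1 : (2 - e) / H <= x - xm by apply: aux; linear.
by apply/andP; split; linear.
Qed.

(** If the maximum point were beyond xm or xp, then the segment from it to the
    centre would contain a point of height 1 - 2 d.  By the concavity of sqrt v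
    the function is there at least 1/8 - d / 100, which [as_near_maximum]
    excludes. *)
Lemma as_max_location (R : realType) (P : profile R) (v : R * R -> R)
    (M H d xbar xm xp : R) (S : almost_strip P v M H d xbar xm xp) ps :
  is_max_point (region P) v ps -> xm <= ps.1 <= xp.
Proof.
move=> [rps mx]; have nP := as_normalised S; have tv := as_torsion S.
have /andP[d0 d1] := as_delta S.
have hl := as_left S; have hr := as_right S; have M2 := as_length S.
have rc : region P (xbar, 1 / 2).
  by apply: interior_subset; apply: (as_interior S); linear.
have vps : 1 / 8 - d / 100 <= v ps by exact: le_trans (as_center S) (mx _ rc).
have cross l xe : 0 < l < 1 -> (xe = xm \/ xe = xp) ->
    (1 - l) * xbar + l * ps.1 = xe -> False.
  move=> l01 hxe E; have /andP[l0 l1] := l01.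
  have := sqrt_torsion_concave nP tv l01 (subset_closure rc) (subset_closure rps).
  have rm : region P (mix l (xbar, 1 / 2) ps).
    by apply: region_mix => //; rewrite !ltW.
  have vm0 := torsion_ge0 nP tv (subset_closure rm).
  move: rm vm0; rewrite /mix /= E; set y := (X in (xe, X)) => rm vm0 conc.
  set c := 1 / 8 - d / 100 in vps.
  have c0 : 0 <= c by rewrite /c; linear.
  have s1 : Num.sqrt c <= Num.sqrt (v (xbar, 1 / 2)) by apply: ler_wsqrtr; exact: as_center S.
  have s2 : Num.sqrt c <= Num.sqrt (v ps) by exact: ler_wsqrtr.
  have s3 : Num.sqrt c <= Num.sqrt (v (xe, y)).
    apply: le_trans conc.
    have h1 : (1 - l) * Num.sqrt c <= (1 - l) * Num.sqrt (v (xbar, 1 / 2)).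
      by rewrite ler_wpM2l// subr_ge0 ltW.
    have h2 : l * Num.sqrt c <= l * Num.sqrt (v ps) by rewrite ler_wpM2l// ltW.
    linear.
  have vm : c <= v (xe, y) by rewrite -ler_sqrt.
  have hxe' : xm <= xe <= xp by case: hxe => ->; linear.
  have [hh _] := as_near_maximum S hxe' rm vm.
  by case: hxe hh => ->; rewrite ?(as_height_left S) ?(as_height_right S); linear.
apply/andP; split; rewrite leNgt; apply/negP => lt.
  have xb : xm < xbar.
    rewrite lt_neqAle; have /andP[_ ->] := hl; rewrite andbT; apply/negP => /eqP xmb.
    by have := as_height_left S; rewrite xmb (as_peak S); linear.
  have q0 : 0 < xbar - ps.1 by linear.
  apply: (cross ((xbar - xm) / (xbar - ps.1)) xm); [|by left|].
    by rewrite divr_gt0 ?ltr_pdivrMr//=; linear.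
  by field; rewrite gt_eqF.
have xb : xbar < xp.
  rewrite lt_neqAle; have /andP[-> _] := hr; rewrite andbT; apply/negP => /eqP xpb.
  by have := as_height_right S; rewrite -xpb (as_peak S); linear.
have q0 : 0 < ps.1 - xbar by linear.
apply: (cross ((xp - xbar) / (ps.1 - xbar)) xp); [|by right|].
  by rewrite divr_gt0 ?ltr_pdivrMr//=; linear.
by field; rewrite gt_eqF.
Qed.

(** If sqrt m is at least the mean of sqrt a and sqrt b, then a + b - 2 m is at
    most (sqrt a - sqrt b) ^ 2 / 2, that is
    (a - b) ^ 2 / (2 (sqrt a + sqrt b) ^ 2). *)
Lemma sqrt_second_difference (R : realType) (a b m e : R) :
  1 / 100 <= a -> 1 / 100 <= b -> 0 <= m ->
  (Num.sqrt a + Num.sqrt b) / 2 <= Num.sqrt m -> `|a - b| <= e ->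
  a + b - 2 * m <= 25 / 2 * e ^+ 2.
Proof.
move=> ha hb m0 conc abe.
have r10 : Num.sqrt (1 / 100) = 1 / 10 :> R.
  by rewrite (_ : 1 / 100 = (1 / 10) ^+ 2); [rewrite sqrtr_sqr ger0_norm//; linear|field].
have A1 : 1 / 10 <= Num.sqrt a by rewrite -r10; exact: ler_wsqrtr.
have B1 : 1 / 10 <= Num.sqrt b by rewrite -r10; exact: ler_wsqrtr.
have aE : a = Num.sqrt a ^+ 2 by rewrite sqr_sqrtr//; linear.
have bE : b = Num.sqrt b ^+ 2 by rewrite sqr_sqrtr//; linear.
have mE : m = Num.sqrt m ^+ 2 by rewrite sqr_sqrtr.
have ab2 : (a - b) ^+ 2 <= e ^+ 2.
  by rewrite -(real_normK (num_real _)) ler_pXn2r ?nnegrE//; exact: le_trans abe.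
move: (Num.sqrt a) (Num.sqrt b) (Num.sqrt m) aE bE mE A1 B1 conc => A B m' aE bE mE A1 B1 conc.
have m2 : ((A + B) / 2) ^+ 2 <= m by rewrite mE ler_pXn2r ?nnegrE//; linear.
have s2 : (1 / 5) ^+ 2 <= (A + B) ^+ 2 by rewrite ler_pXn2r ?nnegrE//; linear.
have d2 : (A - B) ^+ 2 * (1 / 5) ^+ 2 <= (A - B) ^+ 2 * (A + B) ^+ 2.
  by rewrite ler_wpM2l ?sqr_ge0.
have E : (A - B) ^+ 2 * (A + B) ^+ 2 = (a - b) ^+ 2 by rewrite aE bE; ring.
have -> : a + b = 2 * ((A + B) / 2) ^+ 2 + (A - B) ^+ 2 / 2 by rewrite aE bE; field.
rewrite E in d2; linear.
Qed.

(** The concavity of sqrt v turns the bound d / 100 for v_x into a bound for v_xx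
    from above that is quadratic in d. *)
Lemma as_concave (R : realType) (P : profile R) (v : R * R -> R)
    (M H d xbar xm xp : R) (S : almost_strip P v M H d xbar xm xp) s (p : R * R) :
  xm <= p.1 + s <= xp -> xm <= p.1 - s <= xp -> 1 / 5 <= p.2 <= 4 / 5 ->
  ddx v s p <= d ^+ 2 / 200 * s ^+ 2.
Proof.
move=> h1 h2 hy; have /andP[d0 d1] := as_delta S.
have big x : xm <= x <= xp -> region P (x, p.2) /\ 1 / 100 <= v (x, p.2).
  move=> hx; have hm := as_mid_range S hx.
  have ir : region P (x, p.2).
    by apply: interior_subset; apply: (as_interior S) => //; linear.
  split => //; have [/ler_normlP[E _] _] := as_estimate S hx hy.
  have [_ k1 k2 _ _] := as_values S (as_wide_range S hm).
  have : (3 / 20) * (3 / 20) <= (p.2 - f1 P x) * (f2 P x - p.2).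
    by apply: ler_pM; linear.
  move: E; rewrite /v1 /=; linear.
have [r1 b1] := big _ h1; have [r2 b2] := big _ h2.
have hp : xm <= p.1 <= xp by linear.
have [r3 b3] := big _ hp; rewrite -surjective_pairing in r3 b3.
have half : 0 < (1 / 2 : R) < 1 by linear.
have conc := sqrt_torsion_concave (as_normalised S) (as_torsion S) half
  (subset_closure r1) (subset_closure r2).
have mE : mix (1 / 2) (p.1 + s, p.2) (p.1 - s, p.2) = p.
  by rewrite /mix [RHS]surjective_pairing /=; congr (_, _); field.
rewrite mE in conc.
have diff : `|v (p.1 + s, p.2) - v (p.1 - s, p.2)| <= d / 100 * `|2 * s|.
  have := @dx_bound _ v (p.1 - s, p.2) (2 * s) (d / 100).
  rewrite /dx /= (_ : p.1 - s + 2 * s = p.1 + s); last by ring.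
  apply=> x; rewrite ge_min le_max => hx.
  have hx' : xm <= x <= xp by move: hx => /andP[/orP[?|?] /orP[?|?]]; linear.
  have [_ E] := as_estimate S hx' hy; split => //.
  have [C2 _ _ _] := as_torsion S.
  have hy2 : 1 / 20 < p.2 < 19 / 20 by linear.
  have ix := as_interior S (as_mid_range S hx') hy2.
  exact: C2_derivable C2 ix.
have m0 : 0 <= v p by linear.
have conc' : (Num.sqrt (v (p.1 + s, p.2)) + Num.sqrt (v (p.1 - s, p.2))) / 2 <= Num.sqrt (v p).
  linear.
have := sqrt_second_difference b1 b2 m0 conc' diff.
rewrite /ddx exprMn real_normK ?num_real//.
by move=> /le_trans; apply; rewrite le_eqVlt; apply/orP; left; apply/eqP; field.
Qed.

(** In this part v is at most (1 - 3 d / 2) ^ 2 / 8 + d / 100, and at the centre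
    it is at least 1/8 - d / 100. *)
Lemma as_drop (R : realType) (P : profile R) (v : R * R -> R)
    (M H d xbar xm xp : R) (S : almost_strip P v M H d xbar xm xp) x :
  xm <= x <= xp -> height P x <= 1 - 3 / 2 * d ->
  v (x, 1 / 2) <= v (xbar, 1 / 2) - 3 / 10 * d.
Proof.
move=> hx hh; have /andP[d0 d1] := as_delta S.
have hy : 1 / 5 <= (1 / 2 : R) <= 4 / 5 by linear.
have [/ler_normlP[_ E] _] := as_estimate S hx hy.
have c := as_center S; have h1 := v1_le_height P x (1 / 2).
have [_ _ _ _ k] := as_values S (as_wide_range S (as_mid_range S hx)).
have h2 : height P x ^+ 2 <= (1 - 3 / 2 * d) ^+ 2 by rewrite ler_pXn2r ?nnegrE//; linear.
have dd : d * d <= d * (1 / 10) by rewrite ler_wpM2l// ltW.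
have E2 : (1 - 3 / 2 * d) ^+ 2 = 1 - 3 * d + 9 / 4 * (d * d) by field.
rewrite E2 in h2; linear.
Qed.

Lemma le_mean_slope (R : realType) (a q M D : R) :
  0 <= a -> 0 < q <= M -> a <= D * q -> a / M <= D.
Proof.
move=> a0 /andP[q0 qM] h; have M0 : 0 < M by exact: lt_le_trans qM.
have D0 : 0 <= D by rewrite -(pmulr_lge0 _ q0); exact: le_trans h.
by rewrite ler_pdivrMr//; apply: le_trans h _; exact: ler_wpM2l.
Qed.

(** Between the centre and points at distance 1 / (2 H) from xm and xp the
    function drops by 3 d / 10 over a length of at most M.  So v_x is at least
    3 d / (10 M) somewhere on the left, at most - 3 d / (10 M) somewhere on the
    right, and these two points are at distance at most 2 M. *)
Lemma as_curvature_point (R : realType) (P : profile R) (v : R * R -> R)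
    (M H d xbar xm xp : R) (S : almost_strip P v M H d xbar xm xp) :
  exists x, xm + 1 / (2 * H) <= x <= xp - 1 / (2 * H) /\
    D2 v (1, 0) (1, 0) (x, 1 / 2) <= - (3 / 10 / M ^+ 2 * d).
Proof.
have /andP[d0 d1] := as_delta S; have [H0 _] := as_flatness S.
have M2 := as_length S; have hl := as_left S; have hr := as_right S.
have M0 : 0 < M by linear.
have hb : xm <= xbar <= xp by linear.
have : 1 - 0 * d <= height P xbar by rewrite (as_peak S); linear.
move=> /(as_margin S hb); rewrite subr0.
set t := 1 / (2 * H).
have t0 : 0 < t by rewrite /t divr_gt0//; linear.
have -> : 2 / H = 4 * t by rewrite /t; field; rewrite gt_eqF.
have Ht : H * d * t = d / 2 by rewrite /t; field; rewrite gt_eqF.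
move=> marg.
have dropr : v (xp - t, 1 / 2) <= v (xbar, 1 / 2) - 3 / 10 * d.
  apply: (as_drop S); first linear.
  have := as_lipschitz S (x := xp - t) (y := xp).
  have -> : xp - t - xp = - t by ring.
  rewrite (as_height_right S) normrN (gtr0_norm t0) Ht => L.
  have {}L := L _ _; have : height P (xp - t) - (1 - 2 * d) <= d / 2 by apply: L; linear.
  linear.
have dropl : v (xm + t, 1 / 2) <= v (xbar, 1 / 2) - 3 / 10 * d.
  apply: (as_drop S); first linear.
  have := as_lipschitz S (x := xm + t) (y := xm).
  have -> : xm + t - xm = t by ring.
  rewrite (as_height_left S) (gtr0_norm t0) Ht => L.
  have {}L := L _ _; have : height P (xm + t) - (1 - 2 * d) <= d / 2 by apply: L; linear.
  linear.
have [C2 _ _ _] := as_torsion S.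
have ip x : xm <= x <= xp -> (region P)° (x, 1 / 2).
  have hy2 : 1 / 20 < (1 / 2 : R) < 19 / 20 by linear.
  by move=> hx; have ix := as_interior S (as_mid_range S hx) hy2.
have dv x : xm <= x <= xp -> derivable v (x, 1 / 2) (1, 0).
  by move=> /ip; exact: C2_derivable C2.
have d2v x : xm <= x <= xp -> derivable ('D_(1, 0) v) (x, 1 / 2) (1, 0).
  by move=> /ip; exact: C2_derivable2 C2.
have ltr : xbar < xp - t by linear.
have [|x1 hx1 E1] := @mean_value_horizontal _ v xbar (xp - t) (1 / 2) ltr.
  by move=> x hx; apply: dv; linear.
have ltl : xm + t < xbar by linear.
have [|x0 hx0 E0] := @mean_value_horizontal _ v (xm + t) xbar (1 / 2) ltl.
  by move=> x hx; apply: dv; linear.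
have x01 : x0 < x1 by linear.
have [|x hx E] := @mean_value_horizontal _ ('D_(1, 0) v) x0 x1 (1 / 2) x01.
  by move=> x hx; apply: d2v; linear.
exists x; split; first linear.
have a0 : 0 <= 3 / 10 * d by linear.
have k1 : 3 / 10 * d / M <= - 'D_(1, 0) v (x1, 1 / 2).
  apply: (@le_mean_slope _ _ (xp - t - xbar)) => //; first by apply/andP; split; linear.
  rewrite mulNr -E1; linear.
have k0 : 3 / 10 * d / M <= 'D_(1, 0) v (x0, 1 / 2).
  apply: (@le_mean_slope _ _ (xbar - (xm + t))) => //; first by apply/andP; split; linear.
  rewrite -E0; linear.
rewrite -/(D2 v (1, 0) (1, 0) (x, 1 / 2)) in E.
rewrite lerNr.
have -> : 3 / 10 / M ^+ 2 * d = 2 * (3 / 10 * d / M) / (2 * M) by field; rewrite gt_eqF.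
apply: (@le_mean_slope _ _ (x1 - x0)).
- by rewrite mulr_ge0// divr_ge0// ltW.
- by apply/andP; split; linear.
- rewrite mulNr -E; linear.
Qed.

(** * The Hessian near the maximum point *)

Lemma property1_almost_strip (R : realType) (cstar c1 C1 M d xbar : R)
    (P : profile R) (v : R * R -> R) :
  0 < cstar <= 1 / 10 -> 0 < c1 -> 0 < C1 -> admissible cstar c1 C1 -> 2 < M ->
  normalised P -> torsion_function (region P) v ->
  xbar \in `[pa P, pb P] -> height P xbar = 1 ->
  0 < d <= 1 / 10 -> expR (c1 * (2 * M)) / (100 * C1) * d <= 1 / 20 ->
  d <= 100 * C1 * expR (- c1 * (4 * M)) ->
  property1 c1 C1 P xbar M d ->
  exists xm xp, almost_strip P v M (expR (c1 * (2 * M)) / (100 * C1)) d xbar xm xp.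
Proof.
move=> /andP[cs0 cs1] c10 C10 adm M2 nP tv xb hb d01 Hd dM.
move=> [_ _ [xm [xp [[hxm hxp] hm hp Err]]]].
rewrite !in_itv /= in xb hxm hxp.
have M0 : 0 < M by linear.
have /andP[d0 d1] := d01.
have [|len flat] := long_and_flat nP c10 C10 M0 xb hb _ dM.
  by apply: Err; rewrite in_itv /=; linear.
set H := expR _ / _ in Hd flat *.
have H0 : 0 < H by rewrite /H divr_gt0 ?expR_gt0 ?mulr_gt0.
exists xm, xp; split => //; [linear|linear|].
move=> x y hx hy.
have hxP : pa P <= x <= pb P by linear.
have [k1 k2 k3 k4] := normalised_values nP hxP.
have hfl : 1 - height P x <= H * d by apply: flat; linear.
have hh := hfl; rewrite /height in hh.
have xP : x \in `[pa P, pb P] by rewrite in_itv.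
have hhalf : 2^-1 <= height P x by linear.
have hy' : y \in `[f1 P x + cstar, f2 P x - cstar].
  by rewrite in_itv /=; linear.
have E : Error c1 C1 P x <= d / 100 by apply: Err; rewrite in_itv.
have [e1 e2] := adm P v nP tv x xP hhalf y hy'.
split; first exact: le_trans E.
by apply: le_trans (e2 _) E; linear.
Qed.

Theorem theorem1p2 (R : realType) :
  exists cstar0 : R, 0 < cstar0 < 2^-1 /\
  forall cstar c1 C1 : R,
    0 < cstar <= cstar0 -> 0 < c1 -> 0 < C1 -> admissible cstar c1 C1 ->
  forall M : R, 2 < M ->
  exists delta0 c1s C1s : R,
    [/\ 0 < delta0, 0 < c1s, 0 < C1s &
  forall (P : profile R) (v : R * R -> R) (xbar delta : R) (ps : R * R),
    normalised P ->
    torsion_function (region P) v ->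
    is_max_point (region P) v ps ->
    xbar \in `[pa P, pb P] -> height P xbar = 1 ->
    0 < delta <= delta0 ->
    property1 c1 C1 P xbar M delta ->
  forall n : R * R, unit_direction n ->
  forall p : R * R, disc ps c1s p ->
    C1s^-1 * Num.max (`|n.2| ^+ 2) delta <= - D2 v n n p
    /\ - D2 v n n p <= C1s * Num.max (`|n.2| ^+ 2) delta].
Proof.
exists (1 / 10); split; first linear.
move=> cstar c1 C1 cs c10 C10 adm M M2.
have M0 : 0 < M by linear.
pose H := expR (c1 * (2 * M)) / (100 * C1).
have H0 : 0 < H by rewrite /H divr_gt0 ?expR_gt0 ?mulr_gt0.
pose tau := Num.min (1 / (2 * H)) (1 / 10).
have tauH : tau <= 1 / (2 * H) by rewrite /tau ge_min lexx.
have tau10 : tau <= 1 / 10 by rewrite /tau ge_min lexx orbT.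
have tau0 : 0 < tau by rewrite /tau lt_min !divr_gt0// mulr_gt0.
pose kappa := 3 / 10 / M ^+ 2.
have k0 : 0 < kappa by rewrite /kappa divr_gt0 ?exprn_gt0//; linear.
have tau01 : 0 < tau <= 1 / 10 by rewrite tau0.
have [dl [C [dl0 C0 main]]] := hessian_bounds_flat M0 tau01 k0.
pose delta0 := Num.min (Num.min dl (1 / 10))
  (Num.min (1 / 20 / H) (100 * C1 * expR (- c1 * (4 * M)))).
exists delta0, tau, C; split => //.
  have a1 : 0 < 1 / 20 / H by rewrite divr_gt0//; linear.
  have a2 : 0 < 100 * C1 * expR (- c1 * (4 * M)) by rewrite !mulr_gt0 ?expR_gt0.
  by rewrite /delta0 !lt_min dl0 a1 a2 divr_gt0.
move=> P v xbar d ps nP tv mps xb hb /andP[d0 dd] prop n un p hp.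
have [dl1 d10 dH dM] : [/\ d <= dl, d <= 1 / 10, H * d <= 1 / 20 &
    d <= 100 * C1 * expR (- c1 * (4 * M))].
  move: dd; rewrite /delta0 !le_min => /andP[/andP[? ?] /andP[h ?]].
  by split => //; rewrite mulrC -ler_pdivlMr.
have d01 : 0 < d <= 1 / 10 by rewrite d0.
have [xm [xp]] := property1_almost_strip cs c10 C10 adm M2 nP tv xb hb d01 dH dM prop.
rewrite -/H => S.
have [x0 [hx0 curv]] := as_curvature_point S.
have hl := as_left S; have hr := as_right S.
have t8 : 8 * (tau / 8) = tau by field.
have t00 : 0 * (tau / 8) = 0 by rewrite mul0r.
have hps := as_max_location S mps.
have rps : region P (ps.1, ps.2) by rewrite -surjective_pairing; have [] := mps.
have vps : 1 / 8 - d / 100 <= v (ps.1, ps.2).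
  rewrite -surjective_pairing; apply: le_trans (as_center S) _.
  have [_ mx] := mps; apply: mx; apply: interior_subset.
  by apply: (as_interior S); linear.
have [hps1 hps2] := as_near_maximum S hps rps vps.
have marg : xm + 1 / H <= ps.1 <= xp - 1 / H.
  have h1 : 1 - 1 * d <= height P ps.1 by linear.
  have := as_margin S hps h1.
  by rewrite (_ : 2 - 1 = 1)//; ring.
have H2 : 1 / H = 1 / (2 * H) + 1 / (2 * H) by field; rewrite gt_eqF.
have [dp1 dp2] : `|p.1 - ps.1| <= tau /\ `|p.2 - ps.2| <= tau.
  move: hp; rewrite /disc /= => /ltW hp; split; apply: sqr_le_abs => //; try exact: ltW.
    by apply: le_trans hp; rewrite lerDl sqr_ge0.
  by apply: le_trans hp; rewrite lerDr sqr_ge0.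
have Q x y : inset xm xp (tau / 8) 0 (x, y) -> xm <= x <= xp /\ 1 / 5 <= y <= 4 / 5.
  by rewrite /inset t00 /= !addr0 !subr0.
apply: (main xm xp d (region P)° v (x0, 1 / 2)) => //.
- exact: open_interior.
- by have [] := tv.
- move=> q iq; split; first exact: torsion_continuous_at tv iq.
  by have [_ lq _ _] := tv; exact: lq.
- move=> [x y] /Q[hx hy].
  have hy2 : 1 / 20 < y < 19 / 20 by linear.
  by have ixy := as_interior S (as_mid_range S hx) hy2.
- by rewrite d0.
- linear.
- by move=> [x y] /Q[hx hy]; have [] := as_estimate S hx hy.
- by move=> s q /Q[h1 h2] /Q[h3 _]; have := as_concave S h1 h3 h2.
- by move: hx0; rewrite /inset t8 /=; clear -tauH tau10; split; linear.
- rewrite /inset t8; move: dp1 dp2 hps2; rewrite !ler_norml => dp1 dp2 hps2.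
  by move: marg; rewrite H2 => marg; clear -dp1 dp2 hps2 marg tauH tau10; split; linear.
Qed.
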